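(* There is a centralized (sequential) algorithm that, given as input any configuration $G$ (with $n$ nodes and maximum node degree $\Delta$), decides whether or not $G$ is feasible, and runs in time $O(n^3\Delta)$.
   Context: Model. A configuration is a finite simple undirected connected graph $G$ in which each node $v$ is tagged with a non-negative integer $t_v$ (its wakeup tag); by convention the smallest tag is $0$, and the span $\sigma$ of $G$ is the largest tag. Nodes are anonymous (no identifiers) and communicate in synchronous global rounds. A node $v$ wakes up in the first global round $r\le t_v$ in which it receives a message, if any (forced wakeup), and otherwise in global round $t_v$ (spontaneous wakeup). Its local clock is $0$ in its wakeup round; it acts from local round $1$ on, and nodes do not know the global clock. In each round a node either transmits a message to all neighbours, listens, or terminates. A listening node $v$ receives message $M$ if exactly one neighbour transmits (and it transmits $M$), hears a collision (noise, distinguishable from silence and from messages) if at least two neighbours transmit, and hears silence otherwise; a transmitting node hears nothing. The history of $v$ in local round $i\ge 0$ is $\mathcal H_v[i]=(\emptyset)$ if $v$ transmits or listens and hears silence in local round $i$ (or $i=0$ and $v$ woke up spontaneously), $(M)$ if $v$ receives message $M$ in local round $i$ (or $i=0$ and $v$ was woken by $M$), and $( * )$ if a collision occurs at a listening $v$. A distributed radio interaction protocol (DRIP) is a function $D$ mapping finite history vectors to one of $\mathit{listen}$, $\mathit{transmit}(M)$ (for a string $M$), $\mathit{terminate}$; each node $v$ in each local round $i\ge1$ performs $D(\mathcal H_v[0\ldots i-1])$, and it is required that every node eventually outputs $\mathit{terminate}$ in all subsequent rounds. Let $done_v$ be the first local round in which $v$ terminates. A decision function $f$ for $D$ maps the final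 history $\mathcal H_v[0\ldots done_v]$ to $\{0,1\}$. A dedicated leader election algorithm for configuration $G$ is a pair $(D,f)$ such that, when all nodes of $G$ execute $D$, $f$ outputs $1$ at exactly one node of $G$. A configuration is feasible if a dedicated leader election algorithm for it exists. *)

(* Defs.v *)
From mathcomp Require Import all_boot.
Set Implicit Arguments. Unset Strict Implicit. Unset Printing Implicit Defensive.

Definition is_configuration (n : nat) (adj : rel 'I_n) (tag : 'I_n -> nat) : Prop :=
  [/\ irreflexive adj, symmetric adj,
      (forall u v : 'I_n, connect adj u v) &
      (exists v : 'I_n, tag v = 0) ].

Definition max_degree (n : nat) (adj : rel 'I_n) : nat :=
  \max_(v : 'I_n) #|[set u | adj v u]|.

Definition message := seq bool.

Inductive hentry := HEmpty | HMsg of message | HColl.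

Inductive action := Listen | Transmit of message | Terminate.

Definition DRIP := seq hentry -> action.

Section Execution.
Variables (n : nat) (adj : rel 'I_n) (tag : 'I_n -> nat) (D : DRIP).

(* what a listening node hears, given the actions (None = asleep) of all nodes *)
Definition hear (act : 'I_n -> option action) (v : 'I_n) : hentry :=
  let ms := [seq m | u <- enum 'I_n,
                     m <- (if adj v u then
                             (if act u is Some (Transmit m) then [:: m] else [::])
                           else [::])] in
  match ms with
  | [::] => HEmpty
  | [:: m] => HMsg m
  | _ => HColl
  end.

(* [state r v] = Some h iff v is awake at the end of global round r, and then
   h = H_v[0 .. r - w_v] where w_v is its wakeup round.  In global round r+1
   an awake node with history h (of size i = local round) performs D h. *)
Fixpoint state (r : nat) : 'I_n -> option (seq hentry) :=
  match r with
  | 0 => fun v => if tag v == 0 then Some [:: HEmpty] else None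
  | r'.+1 =>
      let st := state r' in
      let act := fun u => if st u is Some h then Some (D h) else None in
      fun v =>
        match st v with
        | Some h =>
            Some (rcons h (if D h is Listen then hear act v else HEmpty))
        | None =>
            match hear act v with
            | HMsg m => Some [:: HMsg m]
            | _ => if tag v == r'.+1 then Some [:: HEmpty]
                   else None
            end
        end
  end.

Definition terminating : Prop :=
  forall v : 'I_n,
    (exists r h, state r v = Some h) /\
    exists r0, forall r h, r0 <= r -> state r v = Some h -> D h = Terminate.

(* [final v h]: h is the final history H_v[0 .. done_v], where done_v >= 1 is
   the first local round in which v terminates.  (The entry H_v[done_v] of the
   terminating round is recorded as (empty).) *)
Definition final (v : 'I_n) (h : seq hentry) : Prop :=
  exists r, state r v = Some h /\
    let i := (size h).-1 in
    [/\ 1 <= i, D (take i h) = Terminate &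
        forall j, 1 <= j < i -> D (take j h) <> Terminate].

End Execution.

Definition dedicated_LE (n : nat) (adj : rel 'I_n) (tag : 'I_n -> nat)
    (D : DRIP) (f : seq hentry -> bool) : Prop :=
  terminating adj tag D /\
  exists v : 'I_n, forall u h, final adj tag D u h -> (f h = true <-> u = v).

Definition feasible (n : nat) (adj : rel 'I_n) (tag : 'I_n -> nat) : Prop :=
  exists D f, dedicated_LE adj tag D f.

(* Centralized sequential algorithms: unit-cost RAM (registers indexed by    *)
(* nat holding nat; constants, addition, truncated subtraction, indirect     *)
(* addressing, conditional jumps).  Each executed instruction costs 1.       *)

Inductive instr :=
  | IConst of nat & nat
  | IAdd of nat & nat & nat
  | ISub of nat & nat & nat
  | ILoad of nat & nat
  | IStore of nat & nat
  | IJz of nat & nat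
  | IJmp of nat
  | IHalt.

Definition program := seq instr.
Definition memory := nat -> nat.

Definition upd (m : memory) (a x : nat) : memory :=
  fun i => if i == a then x else m i.

Definition step (P : program) (s : nat * memory) : option (nat * memory) :=
  let (pc, m) := s in
  match nth IHalt P pc with
  | IConst a k => Some (pc.+1, upd m a k)
  | IAdd a b c => Some (pc.+1, upd m a (m b + m c))
  | ISub a b c => Some (pc.+1, upd m a (m b - m c))
  | ILoad a b => Some (pc.+1, upd m a (m (m b)))
  | IStore a b => Some (pc.+1, upd m (m a) (m b))
  | IJz a l => Some (if m a == 0 then l else pc.+1, m)
  | IJmp l => Some (l, m)
  | IHalt => None
  end.

Fixpoint exec (P : program) (fuel : nat) (s : nat * memory) : option memory :=
  match step P s with
  | None => Some s.2
  | Some s' => if fuel is fuel'.+1 then exec P fuel' s' else None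
  end.

Definition ord_opt (n k : nat) : option 'I_n := insub k.

(* input encoding of a configuration: r[0] = n, r[1+i] = t_i,
   r[1+n+i*n+j] = 1 if {i,j} is an edge, 0 otherwise; all other registers 0 *)
Definition encode (n : nat) (adj : rel 'I_n) (tag : 'I_n -> nat) : memory :=
  fun k =>
    if k == 0 then n
    else if k <= n then
      (if ord_opt n k.-1 is Some i then tag i else 0)
    else if k.-1 - n < n * n then
      let q := (k.-1 - n) %/ n in
      let r := (k.-1 - n) %% n in
      match ord_opt n q, ord_opt n r with
      | Some i, Some j => nat_of_bool (adj i j)
      | _, _ => 0
      end
    else 0.

(* Main.v *)
Require Import Defs.
From mathcomp Require Import all_boot zify.
Set Implicit Arguments. Unset Strict Implicit. Unset Printing Implicit Defensive.

(** Refine the one-class partition of the nodes: two nodes of a class stay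
    together when, for every pair (class C, tag offset d), they have the same
    number (0, 1 or at least 2) of neighbours in C whose tag exceeds theirs by d,
    neighbours with the node's own class and tag being ignored.  The partition
    is stable after n rounds, and the configuration is feasible iff some class
    is then a singleton.

    If no class is a singleton, then under any DRIP two nodes of a class have
    equal histories when time is measured relative to their tags: what a node
    hears depends only on the capped numbers above, and the ignored neighbours
    transmit exactly when the node itself does, hence hears nothing.

    Conversely a protocol can simulate the refinement: in phase k, the nodes of
    the c-th class transmit in the c-th block of 2T+1 rounds (T bounds the tags),
    so that the offset of a neighbour is read off the round in which it is heard.

    On the RAM, unbounded zero-initialised memory lets every round count the
    neighbours in a fresh region addressed by (node, class, offset), after which
    a pair of nodes is compared in O(Delta) steps; n rounds of n^2 comparisons
    cost O(n^3 Delta). *)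

(** * Partition refinement *)

(** Tags are not bounded in terms of [n], so no RAM loop may run over offsets or keys: offsets enter
    only as summands of addresses. The protocol alone spends time proportional to [width], and its
    length is not charged. The machine has no multiplication either; products come from tables of
    multiples made once by repeated addition, and classes are stored already multiplied by [width],
    so that a key is a sum. Labels are compared only at keys realised by actual neighbours, which
    makes a comparison cost the degree; terms free of the degree are absorbed because connectivity
    makes it positive when [n > 1]. Running [n] rounds suffices since every round that changes the
    partition creates a class. The input fills the low registers, so some must be freed before
    ordinary code can run; what is relied on afterwards is only the tags and the strict lower
    triangle of the matrix, and symmetry gives the rest. *)

Section Refinement.
Variables (n : nat) (tg : nat -> nat) (ad : rel nat).

(** An upper bound on the tags that, unlike the maximum, needs additions only; its size is harmless
    because the RAM running time never depends on it. *)
Definition tsum := \sum_(0 <= i < n) tg i.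
Definition width := (tsum + tsum).+1.
(* Identifies the class of [w] together with the offset [tg w - tg v]: the second
   summand is less than [width]. *)
Definition key (c : nat -> nat) v w := width * c w + (tg w + tsum - tg v).
(** Reversed because the RAM loops count down and append neighbours as they meet them. *)
Definition nbrs v := rev [seq w <- iota 0 n | ad v w].
(* Neighbours of the same class and tag transmit in the same rounds as [v]. *)
Definition audible (c : nat -> nat) v w := (c w != c v) || (tg w != tg v).
Definition lab c v x :=
  minn 2 (count (fun w => audible c v w && (key c v w == x)) (nbrs v)).
Definition alike c u v :=
  [&& c u == c v,
      all (fun w => lab c u (key c u w) == lab c v (key c u w)) (nbrs u) &
      all (fun w => lab c u (key c v w) == lab c v (key c v w)) (nbrs v)].
(** A class is named by its least member. Names thus stay below [n], and a descending scan over [u]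
    finds the name by overwriting. *)
Definition refine c v := find (alike c ^~ v) (iota 0 n).
Definition cls k := iter k refine (fun=> 0).

Lemma tg_le v : v < n -> tg v <= tsum.
Proof.
move=> hv; rewrite /tsum (big_cat_nat (n := v)) //=; last by lia.
by rewrite (big_ltn hv); lia.
Qed.

Lemma key_split c v w x : v < n -> w < n ->
  (key c v w == x) = (c w == x %/ width) && (tg w + tsum - tg v == x %% width).
Proof.
move=> hv hw; have h1 := tg_le hv; have h2 := tg_le hw.
have hW : tg w + tsum - tg v < width by rewrite /width; lia.
rewrite /key; apply/eqP/andP => [<-|[/eqP -> /eqP ->]].
  by rewrite mulnC divnMDl ?divn_small ?modnMDl ?modn_small ?addn0.
by rewrite mulnC -divn_eq.
Qed.

Lemma mem_nbrs v w : (w \in nbrs v) = (w < n) && ad v w.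
Proof. by rewrite mem_rev mem_filter mem_iota add0n andbC. Qed.

Lemma lab_notin c v x : x \notin [seq key c v w | w <- nbrs v] -> lab c v x = 0.
Proof.
move=> hx; rewrite /lab (@eq_in_count _ _ pred0) ?count_pred0 // => w hw /=.
by apply/negP=> /andP[_ /eqP E]; case/negP: hx; rewrite -E; apply: map_f.
Qed.

(** Labels vanish away from the keys of actual neighbours, so testing the keys of both lists decides
    equality of the whole label functions. *)
Lemma alikeP c u v :
  reflect (c u = c v /\ lab c u =1 lab c v) (alike c u v).
Proof.
apply: (iffP and3P) => [[/eqP cuv /allP hu /allP hv]|[-> h]]; last first.
  by split=> //; apply/allP => w _; rewrite h.
split=> // x.
case: (boolP (x \in [seq key c u w | w <- nbrs u])) => [/mapP[w hw ->]|xu].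
  exact/eqP/hu.
case: (boolP (x \in [seq key c v w | w <- nbrs v])) => [/mapP[w hw ->]|xv].
  exact/eqP/hv.
by rewrite !lab_notin.
Qed.

Lemma alike_refl c v : alike c v v. Proof. exact/alikeP. Qed.

Lemma alike_sym c u v : alike c u v = alike c v u.
Proof. by apply/alikeP/alikeP => -[h0 h]; split=> // x; rewrite h. Qed.

Lemma alike_trans c u v w : alike c u v -> alike c v w -> alike c u w.
Proof.
move=> /alikeP[h0 h] /alikeP[h1 h']; apply/alikeP.
by split=> [|x]; rewrite ?h0 // h.
Qed.

Lemma has_alike c v : v < n -> has (alike c ^~ v) (iota 0 n).
Proof. by move=> hv; apply/hasP; exists v; rewrite ?mem_iota ?alike_refl. Qed.

Lemma refine_lt c v : v < n -> refine c v < n.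
Proof. by move=> /(has_alike c); rewrite has_find size_iota. Qed.

Lemma refine_alike c v : v < n -> alike c (refine c v) v.
Proof.
move=> hv; have /(nth_find 0) := has_alike c hv.
by rewrite nth_iota ?refine_lt.
Qed.

Lemma refine_eq c u v : u < n -> v < n ->
  (refine c u == refine c v) = alike c u v.
Proof.
move=> hu hv; apply/eqP/idP => [E|E].
  have := refine_alike c hu; rewrite E alike_sym => /alike_trans; apply.
  exact: refine_alike.
apply: eq_find => w /=; apply/idP/idP => h; first exact: alike_trans h E.
by apply: alike_trans h _; rewrite alike_sym.
Qed.

Lemma eq_refine c c' : (forall i, i < n -> c i = c' i) ->
  forall v, v < n -> refine c v = refine c' v.
Proof.
move=> E v hv; apply: eq_in_find => u; rewrite mem_iota add0n => /andP[_ hu].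
have K x w : x < n -> w \in nbrs x -> key c x w = key c' x w.
  by move=> hx; rewrite mem_nbrs => /andP[hw _]; rewrite /key E.
have L x y : x < n -> lab c x y = lab c' x y.
  move=> hx; congr minn; apply: eq_in_count => w hw.
  rewrite (K x w hx hw) /audible (E x) // E //.
  by move: hw; rewrite mem_nbrs => /andP[].
apply/alikeP/alikeP => -[h1 h2]; (split; first by rewrite ?E // -?E).
  by move=> x; rewrite -!L.
by move=> x; rewrite !L.
Qed.

Lemma cls_lt k v : v < n -> cls k v < n.
Proof. by move=> hv; case: k => [|k] /=; [lia | apply: refine_lt]. Qed.

Lemma clsS_eq k u v : u < n -> v < n ->
  (cls k.+1 u == cls k.+1 v) = alike (cls k) u v.
Proof. exact: refine_eq. Qed.

Lemma cls_find k v : v < n ->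
  cls k v = find (fun u => cls k u == cls k v) (iota 0 n).
Proof.
case: k => [|k] hv; first by case: n hv.
apply: eq_in_find => u; rewrite mem_iota => /andP[_ hu].
by rewrite clsS_eq.
Qed.

Lemma cls_rep k v : v < n -> cls k (cls k v) = cls k v.
Proof.
move=> hv.
have : has (fun u => cls k u == cls k v) (iota 0 n).
  by apply/hasP; exists v; rewrite ?mem_iota.
move/(nth_find 0); rewrite -cls_find // nth_iota ?cls_lt //.
by move/eqP.
Qed.

Lemma clsS_sub k u v : u < n -> v < n ->
  cls k.+1 u = cls k.+1 v -> cls k u = cls k v.
Proof. by move=> hu hv /eqP; rewrite clsS_eq // => /alikeP[]. Qed.

Definition reps k := [set i : 'I_n | cls k i == i].

(** The least member of a class remains least in its own part after refinement. *)
Lemma reps_sub k : reps k \subset reps k.+1.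
Proof.
apply/subsetP => i; rewrite !inE => /eqP hi.
have hc : cls k.+1 i < n by rewrite cls_lt.
apply/eqP/anti_leq/andP; split.
  rewrite {1}cls_find // leqNgt; apply/negP=> /(before_find 0).
  by rewrite nth_iota // add0n eqxx.
rewrite -{1}hi cls_find // leqNgt; apply/negP=> /(before_find 0).
rewrite nth_iota // add0n => /eqP[]; apply: clsS_sub => //.
exact: cls_rep.
Qed.

(** The new name of [v] is a leader, hence by hypothesis already an old leader; lying in the old
    class of [v], it is the old name too. *)
Lemma reps_eq k : reps k = reps k.+1 ->
  forall v, v < n -> cls k.+1 v = cls k v.
Proof.
move=> E v hv.
have hc : cls k.+1 v < n by rewrite cls_lt.
have : Ordinal hc \in reps k.+1 by rewrite inE; apply/eqP; exact: cls_rep.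
rewrite -E inE /= => /eqP <-; apply: clsS_sub => //.
exact: cls_rep.
Qed.

(** A round that adds no leader is stable by [reps_eq]; any other round strictly enlarges the set of
    leaders. *)
Lemma cls_progress k : 0 < n ->
  (exists2 j, j < k & forall v, v < n -> cls j.+1 v = cls j v) \/
  k < #|reps k|.
Proof.
move=> n0; elim: k => [|k [[j jk h]|IH]].
- right; apply/card_gt0P; exists (Ordinal n0); by rewrite inE.
- by left; exists j => //; lia.
case: (eqVneq (reps k) (reps k.+1)) => E.
  by left; exists k => //; apply: reps_eq.
right; have : reps k \proper reps k.+1.
  by rewrite properEneq E reps_sub.
by move/proper_card; lia.
Qed.

Lemma cls_stable v : v < n -> cls n.+1 v = cls n v.
Proof.
move=> hv; case: (@cls_progress n) => [|[j jn h]|]; first by lia.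
  (* Stability persists because [refine] sees only the classes of nodes below [n]. *)
  have st i : forall v, v < n -> cls (j + i).+1 v = cls (j + i) v.
    elim: i => [|i IH] u hu; first by rewrite addn0 h.
    by rewrite addnS; apply: (eq_refine IH).
  by rewrite -(subnKC (ltnW jn)) st.
by rewrite ltnNge; have := max_card (mem (reps n)); rewrite card_ord => ->.
Qed.

Lemma cls_alike u v : u < n -> v < n ->
  cls n u = cls n v -> alike (cls n) u v.
Proof. by move=> hu hv E; rewrite -clsS_eq // !cls_stable // E. Qed.

End Refinement.

(** * Indistinguishable nodes *)
Section Hearing.
Variables (n : nat) (adj : rel 'I_n).

Definition sent (a : option action) : option message :=
  if a is Some (Transmit m) then Some m else None.

Definition heard (act : 'I_n -> option action) v :=
  [seq u <- enum 'I_n | adj v u && sent (act u)].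

Lemma hearE act v : hear adj act v =
  match heard act v with
  | [::] => HEmpty
  | [:: u] => HMsg (odflt [::] (sent (act u)))
  | _ => HColl
  end.
Proof.
rewrite /hear /heard; set ms := flatten _.
have -> : ms = [seq odflt [::] (sent (act u)) | u <- enum 'I_n & adj v u && sent (act u)].
  rewrite /ms; elim: (enum 'I_n) => [|u s IH] //=; rewrite IH.
  by case: (adj v u) => //=; case Eu: (act u) => [[|m|]|] //=; rewrite Eu.
by case: [seq _ <- _ | _] => [|u [|u' s]].
Qed.

Lemma mem_heard act v u : (u \in heard act v) = adj v u && sent (act u).
Proof. by rewrite mem_filter mem_enum andbT. Qed.

Lemma uniq_heard act v : uniq (heard act v).
Proof. by rewrite filter_uniq ?enum_uniq. Qed.

(** One half of the comparison of two receptions (same message available, two senders give two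
    senders). Being one-sided, it needs proof for twins in one direction only. *)
Definition dominated act v act' v' :=
  (forall w, w \in heard act v ->
     exists2 z, z \in heard act' v' & sent (act' z) = sent (act w)) /\
  (forall w1 w2, w1 != w2 -> w1 \in heard act v -> w2 \in heard act v ->
     exists z1 z2, [/\ z1 != z2, z1 \in heard act' v' & z2 \in heard act' v']).

Lemma eq_hear act v act' v' :
  dominated act v act' v' -> dominated act' v' act v ->
  hear adj act v = hear adj act' v'.
Proof.
rewrite !hearE; move=> [h1 h2] [h3 h4].
have U := uniq_heard act v; have U' := uniq_heard act' v'.
case: (heard act v) h1 h2 h3 h4 U => [|a [|b s]];
  case: (heard act' v') U' => [|a' [|b' s']] // U' h1 h2 h3 h4 U.
- by have [|z] := h3 a'; rewrite ?mem_head.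
- by have [|z] := h3 a'; rewrite ?mem_head.
- by have [|z] := h1 a; rewrite ?mem_head.
- have [|z] := h1 a; first exact: mem_head.
  by rewrite mem_seq1 => /eqP -> ->.
- have [|||z1 [z2]] := h4 a' b'; rewrite ?inE ?eqxx ?orbT //.
    by apply: contraTneq U' => ->; rewrite /= inE eqxx.
  by move=> [ne /eqP E1 /eqP E2]; rewrite E1 E2 eqxx in ne.
- by have [|z] := h1 a; rewrite ?mem_head.
- have [|||z1 [z2]] := h2 a b; rewrite ?inE ?eqxx ?orbT //.
    by apply: contraTneq U => ->; rewrite /= inE eqxx.
  by move=> [ne /eqP E1 /eqP E2]; rewrite E1 E2 eqxx in ne.
Qed.

End Hearing.

(** Tags and adjacency are extended to all numbers, so that the refinement handles the same objects
    as the RAM. *)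
Definition tagn n (tag : 'I_n -> nat) k := if ord_opt n k is Some i then tag i else 0.
Definition adjn n (adj : rel 'I_n) i j :=
  match ord_opt n i, ord_opt n j with Some i, Some j => adj i j | _, _ => false end.

Section Election.
Variables (n : nat) (adj : rel 'I_n) (tag : 'I_n -> nat).

Local Notation tg := (tagn tag).
Local Notation ad := (adjn adj).
Local Notation T := (tsum n tg).
Local Notation W := (width n tg).
Local Notation cls := (cls n tg ad).
Local Notation lab := (lab n tg ad).
Local Notation key := (key n tg).

Lemma tagnE (v : 'I_n) : tg v = tag v.
Proof. by rewrite /tagn /ord_opt valK. Qed.

Lemma adjnE (v w : 'I_n) : ad v w = adj v w.
Proof. by rewrite /adjn /ord_opt !valK. Qed.

Lemma tag_le (v : 'I_n) : tag v <= T.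
Proof. by rewrite -tagnE; apply: tg_le. Qed.

Lemma labE c (v : 'I_n) x :
  lab c v x = minn 2 #|[set w : 'I_n | [&& adj v w, audible tg c v w & key c v w == x]]|.
Proof.
rewrite cardE {1}/enum_mem size_filter -enumT.
rewrite /lab /nbrs count_rev count_filter -val_enum_ord count_map.
congr minn; apply: eq_count => w /=.
by rewrite [RHS]inE /= adjnE andbC andbA.
Qed.

Lemma lab_ge1 c (v w : 'I_n) : adj v w -> audible tg c v w ->
  0 < lab c v (key c v w).
Proof.
move=> a l; rewrite labE leq_min /=; apply/card_gt0P; exists w.
by rewrite inE a l eqxx.
Qed.

Lemma lab_ge1P c (v : 'I_n) x : 0 < lab c v x ->
  exists w : 'I_n, [/\ adj v w, audible tg c v w & key c v w = x].
Proof.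
rewrite labE leq_min /= => /card_gt0P[w]; rewrite inE => /and3P[? ? /eqP ?].
by exists w.
Qed.

Lemma lab_ge2 c (v w w' : 'I_n) : w != w' -> adj v w -> audible tg c v w ->
  adj v w' -> audible tg c v w' -> key c v w' = key c v w ->
  1 < lab c v (key c v w).
Proof.
move=> ne a l a' l' E; rewrite labE leq_min /=; apply/card_gt1P.
by exists w, w'; rewrite !inE a a' l l' E eqxx.
Qed.

Lemma lab_ge2P c (v : 'I_n) x : 1 < lab c v x ->
  exists w w' : 'I_n, [/\ w != w', adj v w, adj v w', key c v w = x & key c v w' = x].
Proof.
rewrite labE leq_min /= => /card_gt1P[w [w' []]]; rewrite !inE.
by move=> /and3P[? ? /eqP ?] /and3P[? ? /eqP ?] ne; exists w, w'.
Qed.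

Lemma key_eq c (v w v' w' : 'I_n) : key c v w = key c v' w' ->
  c w = c w' /\ tag w + tag v' = tag w' + tag v.
Proof.
move/eqP; rewrite key_split //; set x := key c v' w'.
have /eqP := erefl x; rewrite {1}/x key_split // => /andP[/eqP -> /eqP <-].
move=> /andP[/eqP -> /eqP]; rewrite !tagnE.
have := tag_le v; have := tag_le v'; have := tag_le w; have := tag_le w'; lia.
Qed.

Section Infeasible.
Variable D : DRIP.
Local Notation state := (state adj tag D).

(* Global time shifted by [T.+1], so that every node is asleep at time 0 and
   the recursion of [state] also covers the negative global rounds. *)
Definition shifted r (v : 'I_n) := if T < r then state (r - T.+1) v else None.

Definition acts r (u : 'I_n) := if shifted r u is Some h then Some (D h) else None.

Lemma hear_asleep r v : r <= T -> hear adj (acts r) v = HEmpty.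
Proof.
move=> hr; rewrite hearE; suff -> : heard adj (acts r) v = [::] by [].
rewrite /heard (eq_filter (a2 := pred0)) ?filter_pred0 // => u /=.
by rewrite /acts /shifted ltnNge hr /= andbF.
Qed.

Lemma shiftedS r v : shifted r.+1 v =
  match shifted r v with
  | Some h => Some (rcons h (if D h is Listen then hear adj (acts r) v else HEmpty))
  | None => match hear adj (acts r) v with
            | HMsg m => Some [:: HMsg m]
            | _ => if tag v + T.+1 == r.+1 then Some [:: HEmpty] else None
            end
  end.
Proof.
case: (ltnP T r) => hr; last first.
  have hr' : (T < r) = false by lia.
  rewrite hear_asleep // /shifted hr'.
  case: ltnP => h; last by case: eqP => //; lia.
  have -> : r.+1 - T.+1 = 0 by lia.
  by rewrite /=; have -> : (tag v + T.+1 == r.+1) = (tag v == 0) by lia.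
have hr' : T < r.+1 by lia.
rewrite /shifted hr hr' subSS.
have -> : r - T = (r - T.+1).+1 by lia.
rewrite /=; have <- : (tag v + T.+1 == r.+1) = (tag v == (r - T.+1).+1) by lia.
suff -> : (fun u => if state (r - T.+1) u is Some h then Some (D h) else None)
   = acts r by [].
by rewrite /acts /shifted hr.
Qed.

(** Stability gives [u] and [v] equal labels. An audible sender next to [u] therefore has a
    counterpart next to [v] with the same class and relative tag, which acts alike at the matching
    time by the induction hypothesis. *)
Lemma twin_heard R (u v : 'I_n) ru rv :
  (forall (x y : 'I_n) rx ry, rx <= R -> ry <= R -> cls n x = cls n y ->
     rx + tag y = ry + tag x -> shifted rx x = shifted ry y) ->
  ru <= R -> rv <= R -> cls n u = cls n v -> ru + tag v = rv + tag u ->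
  sent (acts ru u) = None ->
  dominated adj (acts ru) u (acts rv) v.
Proof.
move=> IH hu hv cuv E su.
have /alikeP[_ L] := cls_alike (ltn_ord u) (ltn_ord v) cuv.
have transfer (w z : 'I_n) : key (cls n) v z = key (cls n) u w -> acts rv z = acts ru w.
  move=> /key_eq[cz tz]; rewrite /acts (IH z w rv ru) //; lia.
have aud (w : 'I_n) : w \in heard adj (acts ru) u -> audible tg (cls n) u w.
  rewrite mem_heard => /andP[_]; apply: contraTT.
  rewrite negb_or !negbK !tagnE => /andP[/eqP cw /eqP tw].
  suff -> : acts ru w = acts ru u by rewrite su.
  by rewrite /acts (IH w u ru ru) // tw.
split=> [w hw|w1 w2 ne hw1 hw2].
  have lw := aud _ hw; move: hw; rewrite mem_heard => /andP[aw sw].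
  have := lab_ge1 aw lw; rewrite L => /lab_ge1P[z [az _ /transfer E']].
  by exists z; rewrite ?mem_heard ?az E'.
have lw1 := aud _ hw1; have lw2 := aud _ hw2.
move: hw1 hw2; rewrite !mem_heard => /andP[aw1 sw1] /andP[aw2 sw2].
case: (eqVneq (key (cls n) u w2) (key (cls n) u w1)) => ek.
  have := lab_ge2 ne aw1 lw1 aw2 lw2 ek; rewrite L.
  move=> /lab_ge2P[z1 [z2 [nz a1 a2 /transfer E1 /transfer E2]]].
  by exists z1, z2; rewrite !mem_heard a1 a2 E1 E2 sw1.
have := lab_ge1 aw1 lw1; rewrite L => /lab_ge1P[z1 [a1 _ k1]].
have := lab_ge1 aw2 lw2; rewrite L => /lab_ge1P[z2 [a2 _ k2]].
exists z1, z2; rewrite !mem_heard a1 a2 (transfer _ _ k1) (transfer _ _ k2) sw1 sw2.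
by split=> //; apply: contraNneq ek => E'; rewrite -k1 -k2 E'.
Qed.

(** Twins are compared at different times, so the induction is on a common bound [R] and covers all
    pairs of twins and of times below it. The base is uniform because nobody is awake up to time
    [T]. *)
Lemma twin_shifted R (u v : 'I_n) ru rv : ru <= R -> rv <= R ->
  cls n u = cls n v -> ru + tag v = rv + tag u -> shifted ru u = shifted rv v.
Proof.
have asleep0 r x : r <= T -> shifted r x = None by rewrite /shifted ltnNge => ->.
elim: R u v ru rv => [|R IH] u v ru rv hu hv cuv E.
  by rewrite !asleep0 //; lia.
have Tu := tag_le u; have Tv := tag_le v.
case: ru hu E => [|ru] hu E; first by rewrite !asleep0 //; lia.
case: rv hv E => [|rv] hv E; first by rewrite !asleep0 //; lia.
have E' : ru + tag v = rv + tag u by lia.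
have Euv := IH _ _ _ _ hu hv cuv E'.
have heq : sent (acts ru u) = None -> hear adj (acts ru) u = hear adj (acts rv) v.
  move=> s0; apply: eq_hear; apply: (@twin_heard R) => //.
  by move: s0; rewrite /acts Euv.
rewrite !shiftedS -Euv; case Eu: (shifted ru u) => [h|].
  case Dh: (D h) => [|m|] //; rewrite heq //.
  by rewrite /acts Eu Dh.
rewrite heq; last by rewrite /acts Eu.
by have -> : (tag u + T.+1 == ru.+1) = (tag v + T.+1 == rv.+1) by lia.
Qed.

Lemma twin_state (u v : 'I_n) r h : cls n u = cls n v -> state r v = Some h ->
  exists r', state r' u = Some h.
Proof.
move=> cuv hs; have Tv := tag_le v.
have := @twin_shifted (r + T.+1 + tag u + tag v) v u (r + T.+1) (r + T.+1 + tag u - tag v).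
have h0 : T < r + T.+1 by lia.
rewrite /shifted h0 addnK hs => E.
have {E} : Some h = if T < r + T.+1 + tag u - tag v
  then state (r + T.+1 + tag u - tag v - T.+1) u else None by apply: E => //; lia.
by case: ifP => // _ E; exists (r + T.+1 + tag u - tag v - T.+1).
Qed.

Lemma state_prefix r (v : 'I_n) h j : state r v = Some h -> 0 < j <= size h ->
  exists r', state r' v = Some (take j h).
Proof.
elim: r h => [|r IH] h E /andP[j0 jh].
  exists 0; rewrite E take_oversize //.
  by move: E => /=; case: ifP => // _ [<-].
have [E1|E1] := leqP (size h) j; first by exists r.+1; rewrite take_oversize.
move: E => /=; case Es: (state r v) => [g|].
  move=> [Eh]; have jg : j <= size g by move: E1; rewrite -Eh size_rcons.
  by rewrite -Eh -cats1 takel_cat //; apply: IH; rewrite ?j0.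
case: (hear _ _ _) => [|m|] E; [move: E; case: ifP => // _| |move: E; case: ifP => // _].
- by move=> [Eh]; rewrite -Eh /= in E1; lia.
- by move: E => [Eh]; rewrite -Eh /= in E1; lia.
- by move=> [Eh]; rewrite -Eh /= in E1; lia.
Qed.

Lemma state_nonempty r (v : 'I_n) h : state r v = Some h -> 0 < size h.
Proof.
case: r => [|r] /=; first by case: ifP => // _ [<-].
case: (state r v) => [g [<-]|]; first by rewrite size_rcons.
by case: (hear _ _ _) => [|m|]; try case: ifP => // _; move=> [<-].
Qed.

Lemma state_mono r (v : 'I_n) h d : state r v = Some h ->
  exists g, state (r + d) v = Some (h ++ g).
Proof.
move=> E; elim: d => [|d [g IH]]; first by exists [::]; rewrite addn0 cats0.
by rewrite addnS /= IH -cats1 -catA; eexists.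
Qed.

Lemma final_exists (v : 'I_n) : terminating adj tag D -> exists h, final adj tag D v h.
Proof.
move=> /(_ v)[[r [h0 hs]] [r0 ht]].
have [g hg] := state_mono r0 hs; set h := h0 ++ g in hg.
have Dh := ht _ _ (leq_addl r r0) hg.
(* One more round is run because a final history also contains the entry of the terminating
   round. *)
have [x hS] : exists x, state (r + r0).+1 v = Some (rcons h x).
  by rewrite /= hg; eexists.
have h1 := state_nonempty hg.
pose p j := (0 < j) && if D (take j h) is Terminate then true else false.
have exj : exists j, p j by exists (size h); rewrite /p h1 take_size Dh.
case: (ex_minnP exj) => i /andP[i0 Di] mini.
have ih : i <= size h by apply: mini; rewrite /p h1 take_size Dh.
have sh : size (rcons h x) = (size h).+1 by rewrite size_rcons.
have [|r' hr'] := @state_prefix _ _ _ i.+1 hS; first by rewrite sh.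
have tk j : j <= i -> take j (take i.+1 (rcons h x)) = take j h.
  move=> ji; rewrite -take_min (minn_idPl (leqW ji)) -cats1 takel_cat //.
  exact: leq_trans ji ih.
exists (take i.+1 (rcons h x)), r'; split=> //=.
have -> : (size (take i.+1 (rcons h x))).-1 = i by rewrite size_takel ?sh.
split=> [//||j /andP[j0 ji]]; first by rewrite tk //; case: (D _) Di.
rewrite tk 1?ltnW // => Dj.
by have := mini j; rewrite /p j0 Dj leqNgt ji => /(_ isT).
Qed.

Lemma twin_final (u v : 'I_n) h : cls n u = cls n v ->
  final adj tag D v h -> final adj tag D u h.
Proof. by move=> cuv [r [/(twin_state cuv)[r' E] hf]]; exists r'. Qed.

End Infeasible.

(** The final history of the leader is also one of every node in its class, so the decision function
    would elect them all. *)
Lemma feasible_cls : feasible adj tag ->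
  exists v : 'I_n, forall u : 'I_n, cls n u = cls n v -> u = v.
Proof.
case=> D [f [ht [v hv]]]; exists v => u E.
have [h hf] := final_exists v ht.
have fh : f h = true by apply/(hv v h).
exact: (proj1 (hv u h (twin_final E hf))).
Qed.

End Election.

(** * A protocol computing the refinement *)
Section Protocol.
Variables (n : nat) (adj : rel 'I_n) (tag : 'I_n -> nat).

Local Notation tg := (tagn tag).
Local Notation ad := (adjn adj).
Local Notation T := (tsum n tg).
Local Notation W := (width n tg).
Local Notation cls := (cls n tg ad).
Local Notation lab := (lab n tg ad).
Local Notation key := (key n tg).

(** The last announcement is in local round [n * n * W]; the additional [W] rounds absorb the clock
    differences of neighbours, which are at most [T]. *)
Definition horizon := (n * n).+1 * W.

(* Class [C] transmits in round [(k * n + C).+1 * W] of the local clocks, in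
   order to announce itself for the [k]-th refinement. *)
Definition transmits (v : 'I_n) i :=
  [&& W %| i, 0 < i, (i %/ W).-1 < n * n &
      cls ((i %/ W).-1 %/ n) v == (i %/ W).-1 %% n].

Definition play v i :=
  if horizon <= i then Terminate
  else if transmits v i then Transmit [::] else Listen.

(** The local clock of [w] when that of [v] shows [i]. For a sleeping [w] the truncated difference
    is 0, where [play] listens, so sleep needs no separate case. *)
Definition ambient (v : 'I_n) i w := Some (play w (tag v + i - tag w)).

Definition entry v i :=
  if (0 < i) && (if play v i is Listen then true else false)
  then hear adj (ambient v i) v else HEmpty.

(* The history that [play] is meant to produce; [protocol] recognises it. *)
Definition hist v i := mkseq (entry v) i.

Definition entry_of_count m :=
  match m with 0 => HEmpty | 1 => HMsg [::] | _ => HColl end.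

Lemma horizon_gt0 : 0 < horizon. Proof. by rewrite muln_gt0. Qed.

Lemma W_gt : T + T < W. Proof. by []. Qed.

Lemma off_slot q d : 0 < d < W -> ~~ (W %| q * W + d).
Proof.
move=> /andP[d0 dW]; rewrite dvdn_addr ?dvdn_mull //.
by apply/negP=> /(dvdn_leq d0); lia.
Qed.

Lemma off_slot' q d i : 0 < d < W -> i + d = q * W -> ~~ (W %| i).
Proof.
move=> /andP[d0 dW] E; apply/negP=> hi.
have : W %| d by rewrite -(dvdn_addr _ hi) E dvdn_mull.
by move/(dvdn_leq d0); lia.
Qed.

Lemma on_slot (w : 'I_n) k C : k < n -> C < n ->
  transmits w ((k * n + C).+1 * W) = (cls k w == C).
Proof.
move=> kn Cn; rewrite /transmits dvdn_mull // muln_gt0 mulnK // !andTb [_.+1.-1]/=.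
have n0 : 0 < n by lia.
have -> : k * n + C < n * n by nia.
by rewrite divnMDl // modnMDl divn_small // modn_small // addn0.
Qed.

Lemma sent_play w i m : sent (Some (play w i)) = Some m -> m = [::].
Proof. by rewrite /play; case: ifP => //; case: ifP => // _ _ [<-]. Qed.

Lemma hear_ambient v i : hear adj (ambient v i) v =
  entry_of_count #|[set w | adj v w && sent (ambient v i w)]|.
Proof.
rewrite hearE cardE {1}/enum_mem size_filter.
have -> : count (mem [set w | adj v w && sent (ambient v i w)]) (Finite.enum 'I_n)
          = size (heard adj (ambient v i) v).
  rewrite /heard size_filter enumT; apply: eq_count => w /=; exact: in_set.
case E: (heard _ _ _) => [|a [|b s]] //; congr HMsg.
case Em : (sent (ambient v i a)) => [m|] //; exact: sent_play Em.
Qed.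

(** When [v] is in local round [q * W + d - T], exactly the neighbours of offset code [d] are in
    their round [q * W]. Since [W] is [2T+1], the windows around different slots do not overlap. The
    excluded case, [C] the class of [v] and [d = T], is the round in which [v] itself transmits. *)
Lemma entry_slot k C d (v : 'I_n) : k < n -> C < n -> d < W ->
  (C != cls k v) || (d != T) ->
  entry v ((k * n + C).+1 * W + d - T) =
  entry_of_count (lab (cls k) v (W * C + d)).
Proof.
move=> kn Cn dW loud; set q := (k * n + C).+1; set p := q * W + d - T.
have WT := W_gt; have qW : W <= q * W by rewrite leq_pmull.
have qh : q * W + W <= horizon.
  by rewrite -[X in _ + X]mul1n -mulnDl /horizon leq_mul2r /q; apply/orP; right; nia.
have TW : W = (T + T).+1 by [].
have p0 : 0 < p by rewrite /p; lia.
have -> : entry v p = hear adj (ambient v p) v.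
  rewrite /entry p0 /play.
  have -> : (horizon <= p) = false by rewrite /p; lia.
  suff -> : transmits v p = false by [].
  case: (ltngtP d T) => hd.
  - apply/negP=> /and3P[h _ _]; apply: (negP (@off_slot' q (T - d) p _ _)) h; rewrite /p; lia.
  - apply/negP=> /and3P[h _ _]; move: h; have -> : p = q * W + (d - T) by rewrite /p; lia.
    by apply/negP/off_slot; lia.
  - rewrite /p hd addnK on_slot //; move: loud; rewrite hd eqxx orbF.
    by rewrite eq_sym => /negbTE.
rewrite hear_ambient labE.
set A := [set w | _]; set B := [set w | _].
suff -> : A = B by case: #|B| => [|[|m]] //; rewrite (minn_idPl _).
apply/setP => w; rewrite !inE; case: (adj v w) => //=.
have hk : (key (cls k) v w == W * C + d) = (cls k w == C) && (tag w + T - tag v == d).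
  rewrite key_split // mulnC divnMDl // modnMDl divn_small // modn_small // addn0.
  by rewrite !tagnE.
have tw := tag_le tag w; have tv := tag_le tag v.
rewrite hk /ambient /= /play.
have -> : (horizon <= tag v + p - tag w) = false.
  by apply/negP; rewrite /p; move: qh; rewrite {2}TW; lia.
case: (ltngtP (tag w + T - tag v) d) => hd.
- rewrite !andbF; suff -> : transmits w (tag v + p - tag w) = false by [].
  apply/negP=> /and3P[h _ _]; move: h.
  have -> : tag v + p - tag w = q * W + (tag v + d - T - tag w) by rewrite /p; lia.
  by apply/negP/off_slot; lia.
- rewrite !andbF; suff -> : transmits w (tag v + p - tag w) = false by [].
  apply/negP=> /and3P[h _ _]; move: h; apply/negP.
  by apply: (@off_slot' q (T + tag w - d - tag v)); rewrite /p; lia.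
- have -> : tag v + p - tag w = q * W by rewrite /p; lia.
  rewrite on_slot // !andbT; case: eqP => [cw|] /=; last by rewrite andbF.
  rewrite andbT /audible cw !tagnE; symmetry.
  case/orP: loud => [->//|dT]; apply/orP; right.
  by apply: contraNneq dT => E; rewrite -hd E addKn.
Qed.

Lemma eq_entry_of_count a b : a <= 2 -> b <= 2 ->
  entry_of_count a = entry_of_count b -> a = b.
Proof. by case: a b => [|[|[|a]]] [|[|[|b]]]. Qed.

Lemma nth_hist v i p : p < i -> nth HEmpty (hist v i) p = entry v p.
Proof. by move=> h; rewrite nth_mkseq. Qed.

Lemma hist_cls k (u v : 'I_n) i : k <= n -> (k * n).+1 * W <= i ->
  hist u i = hist v i -> cls k u = cls k v.
Proof.
elim: k => [|k IH] kn hi E //.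
have hi' : (k * n).+1 * W <= i by apply: leq_trans hi; rewrite leq_mul2r; nia.
have cuv := IH (ltnW kn) hi' E.
apply/eqP; rewrite clsS_eq //; apply/alikeP; split=> // x.
have dW : x %% W < W by rewrite ltn_mod.
have lab2 c y z : lab c y z <= 2 by rewrite geq_minl.
have key_x (y w : 'I_n) : (key (cls k) y w == x) = (cls k w == x %/ W) && (tg w + T - tg y == x %% W).
  exact: key_split.
have zero (y : 'I_n) : (forall w : 'I_n, audible tg (cls k) y w -> key (cls k) y w <> x) ->
    lab (cls k) y x = 0.
  move=> h; apply/eqP; rewrite -leqn0 leqNgt; apply/negP.
  by move=> /lab_ge1P[w [_ l /(h w l)]].
(* Such a key names no class at all, so both labels are 0. *)
case: (ltnP (x %/ W) n) => Cn; last first.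
  rewrite !zero // => w _ /eqP; rewrite key_x => /andP[/eqP h _];
    by move: Cn; rewrite -h leqNgt cls_lt.
(* In the remaining case the node is transmitting and learns nothing, but [audible] discards exactly
   these neighbours, so both labels are 0. *)
case: (boolP ((x %/ W != cls k v) || (x %% W != T))) => loud; last first.
  move: loud; rewrite negb_or !negbK => /andP[/eqP hC /eqP hd].
  have K (y : 'I_n) : cls k y = cls k v -> lab (cls k) y x = 0.
    move=> hy; apply: zero => w l /eqP; rewrite key_x hC hd => /andP[/eqP h1 /eqP h2].
    move: l; rewrite /audible h1 hy eqxx /= => /eqP; apply.
    by move: h2 (tg_le tg (ltn_ord y)) (tg_le tg (ltn_ord w)); lia.
  by rewrite !K.
apply: eq_entry_of_count => //.
have xE : x = W * (x %/ W) + x %% W by rewrite mulnC -divn_eq.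
rewrite [in LHS]xE [in RHS]xE -!entry_slot ?cuv //.
rewrite -!(@nth_hist _ i) ?E //.
all: have : (k * n + x %/ W).+1 * W + W <= i by
  apply: leq_trans hi; rewrite -[X in _ + X]mul1n -mulnDl leq_mul2r; apply/orP; right; nia.
all: move: W_gt dW; lia.
Qed.

(** This is what makes [play] a DRIP: classes of phase [k] are used only from round [(k * n).+1 * W]
    on, when [hist_cls] already determines them from the history. *)
Lemma hist_play (u v : 'I_n) i : hist u i = hist v i -> play u i = play v i.
Proof.
move=> E; rewrite /play; case: leqP => // hi.
suff -> : transmits u i = transmits v i by [].
rewrite /transmits; case: (boolP (W %| i)) => //= /dvdnP[[|q] iq]; first by rewrite iq.
rewrite {1 2 3 5 6 7}iq mulnK //=.
case: ltnP => //= qn.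
have n0 : 0 < n by lia.
have kn : q %/ n < n by rewrite ltn_divLR.
rewrite (@hist_cls (q %/ n) u v i) //; first exact: ltnW.
by rewrite iq leq_mul2r ltnS leq_trunc_div orbT.
Qed.

(** An injection into a type with decidable equality, so that histories can be compared by a boolean
    test. *)
Definition code h := if h is HEmpty then None else
  if h is HMsg m then Some (Some m) else Some None.

Lemma code_inj : injective code.
Proof. by move=> [|a|] [|b|] //= [->]. Qed.

Definition matches h v := map code h == map code (hist v (size h)).

Lemma matchesP h v : reflect (h = hist v (size h)) (matches h v).
Proof. by apply: (iffP eqP) => [/(inj_map code_inj)|->] //; rewrite size_mkseq. Qed.

(** The algorithm is dedicated, so the configuration may be wired into it. Which matching node is
    picked does not matter, by [hist_play]. *)
Definition protocol : DRIP := fun h =>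
  if [pick v | matches h v] is Some v then play v (size h) else Terminate.

Lemma size_hist v i : size (hist v i) = i. Proof. exact: size_mkseq. Qed.

Lemma protocol_hist v i : protocol (hist v i) = play v i.
Proof.
rewrite /protocol size_hist; case: pickP => [u|/(_ v)].
  by move/matchesP; rewrite size_hist => /esym/hist_play.
by move/matchesP; rewrite size_hist.
Qed.

Lemma histS v i : hist v i.+1 = rcons (hist v i) (entry v i).
Proof. by rewrite /hist /mkseq -addn1 iotaD map_cat cats1 add0n. Qed.

(** No wakeup is forced: transmissions begin in local round [W], which exceeds every tag, so all
    nodes have woken up spontaneously by then. *)
Lemma state_protocol r (v : 'I_n) : state adj tag protocol r v =
  if tag v <= r then Some (hist v (r - tag v).+1) else None.
Proof.
elim: r v => [|r IH] v; first by rewrite /= leqn0; case: eqP => // ->.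
set act := fun u => if state adj tag protocol r u is Some h
                    then Some (protocol h) else None.
have sact (u : 'I_n) : sent (act u) = sent (Some (play u (r.+1 - tag u))).
  rewrite /act IH; case: leqP => h; first by rewrite protocol_hist subSn.
  have -> : r.+1 - tag u = 0 by lia.
  by rewrite /play leqNgt horizon_gt0 /transmits ltnn andbF.
have heq : forall w : 'I_n, sent (act w) = sent (ambient v (r.+1 - tag v) w)
    \/ r.+1 < tag v.
  move=> w; case: (ltnP r.+1 (tag v)) => h; [by right | left].
  by rewrite sact /ambient subnKC.
have -> : state adj tag protocol r.+1 v =
  match state adj tag protocol r v with
  | Some h => Some (rcons h (if protocol h is Listen then hear adj act v else HEmpty))
  | None => match hear adj act v with
            | HMsg m => Some [:: HMsg m]
            | _ => if tag v == r.+1 then Some [:: HEmpty] else None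
            end
  end by [].
rewrite IH; case: leqP => h.
  rewrite ltnW ?ltnS // subSn // [hist v _.+2]histS protocol_hist; congr (Some (rcons _ _)).
  rewrite /entry /=; case: (play _ _) => //.
  rewrite !hearE /heard.
  have hs w : sent (act w) = sent (ambient v (r - tag v).+1 w).
    by rewrite sact /ambient -subSn // subnKC // ltnW.
  rewrite (eq_filter (a2 := fun u => adj v u && sent (ambient v (r - tag v).+1 u))).
    by case: [seq _ <- _ | _] => [|a [|b s]] //; rewrite hs.
  by move=> w /=; rewrite hs.
have -> : hear adj act v = HEmpty.
  rewrite hearE /heard (eq_filter (a2 := pred0)) ?filter_pred0 // => w /=.
  suff -> : sent (act w) = None by rewrite andbF.
  rewrite sact /play; case: leqP => //= _.
  suff -> : transmits w (r.+1 - tag w) = false by [].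
  apply/negP=> /and3P[/dvdnP[[|q] E] w0 _]; first by rewrite E in w0.
  have := tag_le tag v; have := W_gt; rewrite mulSn in E; lia.
case: (ltngtP (tag v) r.+1) => h'; first by lia.
- by [].
- by rewrite h' subnn.
Qed.

Lemma play_terminate v i : play v i = Terminate -> horizon <= i.
Proof. by rewrite /play; case: leqP => // _; case: ifP. Qed.

Lemma final_protocol (v : 'I_n) h : final adj tag protocol v h -> h = hist v horizon.+1.
Proof.
case=> r []; rewrite state_protocol; case: leqP => // _ [<-].
rewrite size_hist /=; set i := r - tag v; move=> [i0 Di mini].
have tk j : j <= i -> take j (hist v i.+1) = hist v j.
  by move=> ji; rewrite /hist /mkseq -map_take take_iota (minn_idPl (leqW ji)).
rewrite tk // protocol_hist in Di.
move/play_terminate: Di; rewrite leq_eqVlt => /predU1P[->//|hi].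
case: (mini horizon); first by rewrite horizon_gt0.
by rewrite tk ?(ltnW hi) // protocol_hist /play leqnn.
Qed.

(** The decision function recognises the final history of [v]; by [hist_cls] at [k = n], a node
    sharing it shares the class of [v]. *)
Lemma cls_feasible (v : 'I_n) : (forall u : 'I_n, cls n u = cls n v -> u = v) ->
  feasible adj tag.
Proof.
move=> sing; exists protocol, (fun h => map code h == map code (hist v horizon.+1)); split.
  move=> u; split.
    by exists (tag u), (hist u 1); rewrite state_protocol leqnn subnn.
  exists (tag u + horizon) => r h hr; rewrite state_protocol.
  have hh : horizon <= (r - tag u).+1 by move: hr; set x := horizon; lia.
  by case: leqP => // _ [<-]; rewrite protocol_hist /play hh.
exists v => u h /final_protocol ->; split=> [/eqP/(inj_map code_inj) E|->]; last exact: eqxx.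
apply: sing; exact: (@hist_cls n u v horizon.+1).
Qed.

End Protocol.

Lemma feasibleP n (adj : rel 'I_n) (tag : 'I_n -> nat) :
  feasible adj tag <->
  exists2 v, v < n & forall u, u < n ->
    cls n (tagn tag) (adjn adj) n u = cls n (tagn tag) (adjn adj) n v -> u = v.
Proof.
split=> [/feasible_cls[v hv]|[v vn hv]].
  by exists v => // u un E; have <- := hv (Ordinal un) E.
apply: (@cls_feasible _ _ _ (Ordinal vn)) => u E.
by apply: val_inj; apply: hv E; exact: ltn_ord.
Qed.

(** * Structured RAM programs *)
Inductive cmd :=
  | Skip
  | Do of instr
  | Seq of cmd & cmd
  | If of nat & cmd & cmd
  | While of nat & cmd.

Fixpoint compile l c : seq instr :=
  match c with
  | Skip => [::]
  | Do i => [:: i]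
  | Seq a b => let ca := compile l a in ca ++ compile (l + size ca) b
  | If r a b =>
      let ca := compile l.+1 a in
      let cb := compile (l + size ca).+2 b in
      IJz r (l + size ca).+2 :: ca ++ IJmp (l + size ca + size cb).+2 :: cb
  | While r a =>
      let ca := compile l.+1 a in
      IJz r (l + size ca).+2 :: ca ++ [:: IJmp l]
  end.

Definition basic i (m : memory) : option memory :=
  match i with
  | IConst a k => Some (upd m a k)
  | IAdd a b c => Some (upd m a (m b + m c))
  | ISub a b c => Some (upd m a (m b - m c))
  | ILoad a b => Some (upd m a (m (m b)))
  | IStore a b => Some (upd m (m a) (m b))
  | _ => None
  end.

(** The number counts machine instructions: a true [If] pays for the test and for the jump over the
    other branch, a loop iteration for the test and the jump back. *)
Inductive ev : cmd -> memory -> nat -> memory -> Prop :=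
  | ev_skip m : ev Skip m 0 m
  | ev_do i m m' of basic i m = Some m' : ev (Do i) m 1 m'
  | ev_seq a b m m1 m2 t1 t2 of ev a m t1 m1 & ev b m1 t2 m2 :
      ev (Seq a b) m (t1 + t2) m2
  | ev_ifT r a b m t m' of m r != 0 & ev a m t m' : ev (If r a b) m t.+2 m'
  | ev_ifF r a b m t m' of m r == 0 & ev b m t m' : ev (If r a b) m t.+1 m'
  | ev_whileF r a m of m r == 0 : ev (While r a) m 1 m
  | ev_whileT r a m m1 m2 t1 t2 of m r != 0 & ev a m t1 m1 &
      ev (While r a) m1 t2 m2 : ev (While r a) m (t1 + t2).+2 m2.

Definition code_at (P : program) l (code : seq instr) :=
  forall i, i < size code -> nth IHalt P (l + i) = nth IHalt code i.

Lemma code_at_cat P l a b : code_at P l (a ++ b) ->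
  code_at P l a /\ code_at P (l + size a) b.
Proof.
move=> h; split=> i hi.
  by rewrite h ?size_cat 1?ltn_addr // nth_cat hi.
by rewrite -addnA h ?size_cat ?ltn_add2l // nth_cat ltnNge leq_addr /= addKn.
Qed.

Lemma code_at_cons P l i a : code_at P l (i :: a) ->
  nth IHalt P l = i /\ code_at P l.+1 a.
Proof.
move=> h; split=> [|j hj]; first by have := h 0 isT; rewrite addn0.
by rewrite addSnnS; apply: (h j.+1).
Qed.

Lemma compile_correct c m t m' : ev c m t m' -> forall P l f,
  code_at P l (compile l c) ->
  exec P (t + f) (l, m) = exec P f (l + size (compile l c), m').
Proof.
elim=> {c m t m'}.
- by move=> m P l f _; rewrite addn0.
- move=> i m m' hi P l f /code_at_cons[E _]; rewrite add1n addn1 /= E.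
  by case: i hi {E} => //= [a k|a b c|a b c|a b|a b] [<-].
- move=> a b m m1 m2 t1 t2 _ IH1 _ IH2 P l f /= /code_at_cat[h1 h2].
  by rewrite -addnA IH1 // IH2 // size_cat addnA.
- move=> r a b m t m' /negbTE hr _ IH P l f h.
  have -> : t.+2 + f = (t + f.+1).+1 by lia.
  have /= /code_at_cons[E /code_at_cat[h1 /code_at_cons[E2 _]]] := h.
  rewrite E hr IH //= E2.
  by rewrite size_cat /=; congr (exec _ _ (_, _)); lia.
- move=> r a b m t m' hr _ IH P l f /= /code_at_cons[E /code_at_cat[_]].
  move=> /code_at_cons[_ h]; rewrite E hr.
  rewrite addSn in h.
  by rewrite IH // size_cat /=; congr (exec _ _ (_, _)); lia.
- move=> r a m hr P l f /= /code_at_cons[E _]; rewrite E hr.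
  by rewrite size_cat /=; congr (exec _ _ (_, _)); lia.
- move=> r a m m1 m2 t1 t2 /negbTE hr _ IH1 _ IH2 P l f h.
  have -> : (t1 + t2).+2 + f = (t1 + (t2 + f).+1).+1 by lia.
  have /= /code_at_cons[E /code_at_cat[h1 /code_at_cons[E2 _]]] := h.
  rewrite E hr IH1 //= E2.
  exact: IH2.
Qed.

Lemma exec_compile c m t m' f : ev c m t m' -> t <= f ->
  exec (compile 0 c) f (0, m) = Some m'.
Proof.
move=> hc /subnKC <-; rewrite (compile_correct hc) //.
(* Running past the end of the program reads the default [IHalt]. *)
have E : step (compile 0 c) (0 + size (compile 0 c), m') = None.
  by rewrite /= nth_default.
by case: (f - t) => [|k]; rewrite /exec -/exec E.
Qed.

Fixpoint line (s : seq instr) : cmd :=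
  if s is i :: s' then Seq (Do i) (line s') else Skip.

Fixpoint runs (s : seq instr) (m : memory) : option memory :=
  if s is i :: s' then (if basic i m is Some m' then runs s' m' else None)
  else Some m.

Lemma ev_line s m m' : runs s m = Some m' -> ev (line s) m (size s) m'.
Proof.
elim: s m => [|i s IH] m /=; first by move=> [<-]; apply: ev_skip.
case E: (basic i m) => [m1|] // /IH h.
by rewrite -add1n; apply: ev_seq h; apply: ev_do.
Qed.

(** * Variables and arrays on top of the registers *)

Record store := Store { va : nat -> nat; ar : nat -> nat -> nat }.

(* [eqn] rather than [==]: [lazy] then evaluates variable lookups in a block,
   where [simpl] would blow up exponentially. *)
Definition setv s x k := Store (fun y => if eqn y x then k else va s y) (ar s).
Definition seta s a i k :=
  Store (va s) (fun b => if eqn b a then upd (ar s b) i k else ar s b).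

(* Registers below [nvars] hold the variables, register [base] the address at
   which the arrays start, and [tmp1], [tmp2] are scratch. *)
Definition nvars := 40.
Definition base := 40.
Definition tmp1 := 41.
Definition tmp2 := 42.

Inductive hinstr :=
  | Hconst of nat & nat
  | Hadd of nat & nat & nat
  | Hsub of nat & nat & nat
  | Haddc of nat & nat & nat
  | Hsubc of nat & nat & nat
  | Hget of nat & nat & nat
  | Hput of nat & nat & nat.

Definition hstep (s : store) h :=
  match h with
  | Hconst x k => setv s x k
  | Hadd x y z => setv s x (va s y + va s z)
  | Hsub x y z => setv s x (va s y - va s z)
  | Haddc x y k => setv s x (va s y + k)
  | Hsubc x y k => setv s x (va s y - k)
  | Hget x a y => setv s x (ar s a (va s y))
  | Hput a y x => seta s a (va s y) (va s x)
  end.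

Fixpoint hruns (hs : seq hinstr) s := if hs is h :: hs' then hruns hs' (hstep s h) else s.

Definition hvalid h :=
  match h with
  | Hconst x _ => x < nvars
  | Hadd x y z | Hsub x y z => [&& x < nvars, y < nvars & z < nvars]
  | Haddc x y _ | Hsubc x y _ => (x < nvars) && (y < nvars)
  | Hget x a y | Hput a y x => [&& x < nvars, a < 8 & y < nvars]
  end.

(** Three doublings produce the factor 8 of the interleaved layout. *)
Definition addr a y :=
  [:: IAdd tmp1 y y; IAdd tmp1 tmp1 tmp1; IAdd tmp1 tmp1 tmp1;
      IConst tmp2 a; IAdd tmp1 tmp1 tmp2; IAdd tmp1 tmp1 base].

Definition hcode h :=
  match h with
  | Hconst x k => [:: IConst x k]
  | Hadd x y z => [:: IAdd x y z]
  | Hsub x y z => [:: ISub x y z]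
  | Haddc x y k => [:: IConst tmp1 k; IAdd x y tmp1]
  | Hsubc x y k => [:: IConst tmp1 k; ISub x y tmp1]
  | Hget x a y => addr a y ++ [:: ILoad x tmp1]
  | Hput a y x => addr a y ++ [:: IStore tmp1 x]
  end.

Definition block hs := line (flatten (map hcode hs)).

(** The decrement undoes the shift by one in stored entries, which keeps 0 free as terminator; the
    body sees the true neighbour in [w]. *)
Definition walk p w body :=
  Seq (block [:: Hget w 4 p])
      (While w (Seq (block [:: Hsubc w w 1])
               (Seq body (block [:: Haddc p p 1; Hget w 4 p])))).

Definition cell (L : seq nat) k := if k < size L then (nth 0 L k).+1 else 0.

(** * Weakest preconditions with time bounds *)

Section Wp.
Variables (raw : nat -> nat) (B : nat).
Hypothesis B_gt : tmp2 < B.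

(* The arrays are interleaved: cell [i] of array [a] is register [B + 8 i + a]. *)
Record rep (s : store) (m : memory) : Prop := Rep {
  rep_var : forall x, x < nvars -> m x = va s x;
  rep_base : m base = B;
  rep_arr : forall a i, a < 8 -> m (B + 8 * i + a) = ar s a i;
  rep_raw : forall x, tmp2 < x < B -> m x = raw x }.

Lemma rep_setv s m x k : rep s m -> x < nvars -> rep (setv s x k) (upd m x k).
Proof.
move=> [h1 h2 h3 h4] hx; have := B_gt; rewrite /nvars /tmp2 in hx *; move=> hB.
split=> [y hy||a i ha|y hy]; rewrite /= /upd /=.
- by rewrite -eqnE; case: eqnP => // _; apply: h1.
- by rewrite ifF //; rewrite /base; lia.
- by rewrite ifF; [apply: h3 | lia].
- by rewrite ifF; [apply: h4 | move: hy; rewrite /tmp2; lia].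
Qed.

Lemma rep_tmp s m x k : rep s m -> base < x <= tmp2 -> rep s (upd m x k).
Proof.
move=> [h1 h2 h3 h4] hx; have := B_gt; rewrite /base /tmp2 in hx *; move=> hB.
split=> [y hy||a i ha|y hy]; rewrite /= /upd /=.
- by rewrite ifF; [apply: h1 | move: hy; rewrite /nvars; lia].
- by rewrite ifF //; rewrite /base; lia.
- by rewrite ifF; [apply: h3 | lia].
- by rewrite ifF; [apply: h4 | move: hy; rewrite /tmp2; lia].
Qed.

Lemma rep_seta s m a i k : rep s m -> a < 8 ->
  rep (seta s a i k) (upd m (B + 8 * i + a) k).
Proof.
move=> [h1 h2 h3 h4] ha; have := B_gt; rewrite /tmp2 => hB.
split=> [y hy||b j hb|y hy]; rewrite /= /upd /=.
- by rewrite ifF; [apply: h1 | move: hy; rewrite /nvars; lia].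
- by rewrite ifF //; rewrite /base; lia.
- case: eqP => E; last first.
    by rewrite h3 //; case: eqnP => // E1; rewrite ifF //; apply/eqP; lia.
  have [-> ->] : b = a /\ j = i by lia.
  by rewrite eqnE !eqxx.
- by rewrite ifF; [apply: h4 | lia].
Qed.

Lemma runs_addr s m a y : rep s m -> y < nvars ->
  exists m', [/\ runs (addr a y) m = Some m', rep s m' &
                 m' tmp1 = B + 8 * va s y + a].
Proof.
move=> hm hy; eexists; split; first by [].
  by do !apply: rep_tmp => //.
rewrite /upd /= (rep_base hm) (rep_var hm hy); lia.
Qed.

Lemma runs_cat a b m m' : runs a m = Some m' -> runs (a ++ b) m = runs b m'.
Proof.
elim: a m => [|i a IH] m /=; first by move=> [->].
by case: (basic i m) => // m1; apply: IH.
Qed.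

Lemma runs_hcode s m h : rep s m -> hvalid h ->
  exists2 m', runs (hcode h) m = Some m' & rep (hstep s h) m'.
Proof.
move=> hm; case: h.
- by move=> x k hx /=; eexists; [reflexivity | apply: rep_setv].
- move=> x y z /= /and3P[hx hy hz]; eexists; first reflexivity.
  by rewrite !(rep_var hm) //; apply: rep_setv.
- move=> x y z /= /and3P[hx hy hz]; eexists; first reflexivity.
  by rewrite !(rep_var hm) //; apply: rep_setv.
- move=> x y k /= /andP[hx hy]; eexists; first reflexivity.
  have hm' := rep_tmp (x := tmp1) k hm isT.
  by rewrite (rep_var hm') //; apply: rep_setv.
- move=> x y k /= /andP[hx hy]; eexists; first reflexivity.
  have hm' := rep_tmp (x := tmp1) k hm isT.
  by rewrite (rep_var hm') //; apply: rep_setv.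
- move=> x a y hv; have /and3P[hx ha hy] : [&& x < nvars, a < 8 & y < nvars] := hv.
  have [m' [E hm' Et]] := runs_addr a hm hy.
  rewrite [hcode _]/(addr a y ++ [:: ILoad x tmp1]) (runs_cat _ E) /=.
  by eexists; first reflexivity; rewrite Et (rep_arr hm') //; apply: rep_setv.
- move=> a y x hv; have /and3P[hx ha hy] : [&& x < nvars, a < 8 & y < nvars] := hv.
  have [m' [E hm' Et]] := runs_addr a hm hy.
  rewrite [hcode _]/(addr a y ++ [:: IStore tmp1 x]) (runs_cat _ E) /=.
  by eexists; first reflexivity; rewrite Et (rep_var hm') //; apply: rep_seta.
Qed.

Lemma size_hcode h : size (hcode h) <= 7. Proof. by case: h. Qed.

Lemma runs_block s m hs : rep s m -> all hvalid hs ->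
  exists2 m', runs (flatten (map hcode hs)) m = Some m' & rep (hruns hs s) m'.
Proof.
elim: hs s m => [|h hs IH] s m hm /=; first by exists m.
move=> /andP[/(runs_hcode hm)[m1 E1 h1] /(IH _ _ h1)[m2 E2 h2]].
by exists m2; rewrite ?(runs_cat _ E1).
Qed.

Lemma size_block hs : size (flatten (map hcode hs)) <= 7 * size hs.
Proof. by elim: hs => //= h hs; rewrite size_cat; have := size_hcode h; lia. Qed.

Definition wp (c : cmd) (t : nat) (Q : store -> Prop) (s : store) : Prop :=
  forall m, rep s m -> exists t' m' s', [/\ ev c m t' m', t' <= t, rep s' m' & Q s'].

Lemma wp_block hs (Q : store -> Prop) s : all hvalid hs -> Q (hruns hs s) ->
  wp (block hs) (7 * size hs) Q s.
Proof.
move=> hv q m /runs_block/(_ hv)[m' E hm'].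
exists (size (flatten (map hcode hs))), m', (hruns hs s).
by split=> //; [apply: ev_line | apply: size_block].
Qed.

Lemma wp_skip Q s : Q s -> wp Skip 0 Q s.
Proof. by move=> q m hm; exists 0, m, s; split=> //; apply: ev_skip. Qed.

Lemma wp_raw x y (Q : store -> Prop) s : x < nvars -> y < nvars -> tmp2 < va s y < B ->
  Q (setv s x (raw (va s y))) -> wp (Do (ILoad x y)) 1 Q s.
Proof.
move=> hx hy hr q m hm; exists 1, (upd m x (m (m y))), (setv s x (raw (va s y))).
split=> //; first exact: ev_do.
by rewrite (rep_var hm hy) (rep_raw hm hr); apply: rep_setv.
Qed.

Lemma wp_seq a b t1 t2 Q s :
  wp a t1 (wp b t2 Q) s -> wp (Seq a b) (t1 + t2) Q s.
Proof.
move=> ha m /ha[u1 [m1 [s1 [e1 l1 r1]]]] /(_ m1 r1)[u2 [m2 [s2 [e2 l2 r2 q]]]].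
exists (u1 + u2), m2, s2; split=> //; first exact: ev_seq e1 e2.
exact: leq_add.
Qed.

Lemma wp_le a t t' (Q Q' : store -> Prop) s : t <= t' -> (forall s, Q s -> Q' s) ->
  wp a t Q s -> wp a t' Q' s.
Proof.
move=> le qq ha m /ha[u [m1 [s1 [e l r /qq q]]]].
by exists u, m1, s1; split=> //; apply: leq_trans le.
Qed.

Lemma wp_if x a b t1 t2 Q s : x < nvars ->
  (va s x != 0 -> wp a t1 Q s) -> (va s x = 0 -> wp b t2 Q s) ->
  wp (If x a b) (t1 + t2).+2 Q s.
Proof.
move=> hx ha hb m hm; case: (eqVneq (va s x) 0) => h.
  have [u [m1 [s1 [e l r q]]]] := hb h m hm.
  exists u.+1, m1, s1; split=> //; last by rewrite ltnS leqW // (leq_trans l) ?leq_addl.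
  by apply: ev_ifF => //; rewrite (rep_var hm) // h.
have [u [m1 [s1 [e l r q]]]] := ha h m hm.
exists u.+2, m1, s1; split=> //; last by rewrite !ltnS (leq_trans l) ?leq_addr.
by apply: ev_ifT => //; rewrite (rep_var hm).
Qed.

(** The invariant is indexed by the number of iterations left, and [x] need only vanish exactly when
    none is left; this covers both countdowns and list walks. *)
Lemma wp_while x a t N (I : nat -> store -> Prop) s : x < nvars ->
  (forall i s, I i s -> (va s x == 0) = (i == 0)) ->
  (forall i s, i < N -> I i.+1 s -> wp a t (I i) s) ->
  I N s -> wp (While x a) (N * (t + 2)).+1 (I 0) s.
Proof.
move=> hx hz; elim: N s => [|N IH] s step IN m hm.
  exists 1, m, s; split=> //; apply: ev_whileF.
  by rewrite (rep_var hm) // (hz _ _ IN).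
have [u [m1 [s1 [e l r q]]]] := step N s (ltnSn N) IN m hm.
have step' i s2 : i < N -> I i.+1 s2 -> wp a t (I i) s2.
  by move=> hi; apply: step; apply: leqW.
have [u2 [m2 [s2 [e2 l2 r2 q2]]]] := IH s1 step' q m1 r.
exists (u + u2).+2, m2, s2; split=> //; last by rewrite mulSn; lia.
by apply: ev_whileT e e2; rewrite (rep_var hm) // (hz _ _ IN).
Qed.

Definition loop x body := While x (Seq (block [:: Hsubc x x 1]) body).

Lemma wp_seq_mid (R : store -> Prop) a b t1 t2 Q s :
  wp a t1 R s -> (forall s', R s' -> wp b t2 Q s') -> wp (Seq a b) (t1 + t2) Q s.
Proof. by move=> ha hb; apply: wp_seq; apply: wp_le ha. Qed.

Lemma wp_bound a t t' Q s : t <= t' -> wp a t Q s -> wp a t' Q s.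
Proof. by move=> le; apply: wp_le. Qed.

Lemma wp_loop (I : nat -> store -> Prop) N x body t (Q : store -> Prop) s :
  x < nvars -> I N s ->
  (forall i s, I i s -> va s x = i) ->
  (forall i s, i < N -> I i.+1 s -> wp body t (I i) (setv s x i)) ->
  (forall s, I 0 s -> Q s) ->
  wp (loop x body) (N * (t + 9)).+1 Q s.
Proof.
move=> hx IN hi step hQ.
(* 7 bounds the code of the decrement, 2 is the loop overhead. *)
have -> : N * (t + 9) = N * (7 * 1 + t + 2) by lia.
apply: wp_le (leqnn _) hQ _.
apply: wp_while IN => // [i s1 /hi -> //|i s1 iN Is].
apply: wp_seq; apply: wp_block; first by rewrite /= hx.
by rewrite /= (hi _ _ Is) subn1; apply: step.
Qed.

Lemma wp_walk (J : nat -> store -> Prop) L p0 p w body t (Q : store -> Prop) s :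
  p < nvars -> w < nvars -> p != w ->
  (forall i s, J i s -> forall k, k <= size L -> ar s 4 (p0 + k) = cell L k) ->
  (forall i s x, J i s -> J i (setv s w x)) ->
  (forall i s x, J i s -> J i (setv s p x)) ->
  (forall i s, i < size L -> J i s -> va s p = p0 + i -> va s w = nth 0 L i ->
     wp body t (fun s' => J i.+1 s' /\ va s' p = p0 + i) s) ->
  J 0 s -> va s p = p0 -> (forall s, J (size L) s -> Q s) ->
  wp (walk p w body) (size L * (t + 23) + 8) Q s.
Proof.
move=> hp hw /negbTE pw hL Jw Jp step J0 e0 hQ; apply: wp_le (leqnn _) hQ _.
pose I i s := [/\ i <= size L, J (size L - i) s, va s p = p0 + (size L - i)
  & va s w = cell L (size L - i)].
have -> : size L * (t + 23) + 8 = 7 * 1 + (size L * (7 * 1 + (t + 7 * 2) + 2)).+1 by lia.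
apply: wp_seq; apply: wp_block; first by rewrite /= hp hw.
have hI : I (size L) (hruns [:: Hget w 4 p] s).
  rewrite /I subnn /=; split=> //; first exact: Jw.
    by rewrite eqnE pw e0 addn0.
  by rewrite eqnE eqxx e0; have := hL _ _ J0 0; rewrite addn0; apply.
apply: wp_le (leqnn _) _ (wp_while hw _ _ hI) => //.
- by move=> s1 []; rewrite subn0.
- move=> i s1 [i1 _ _ ->]; rewrite /cell.
  case: i i1 => [|i] hi; first by rewrite subn0 ltnn.
  by rewrite ifT //; lia.
- move=> i s1 hi [_ J1 e1 e2].
  apply: wp_seq; apply: wp_block; first by rewrite /= hw.
  apply: wp_seq; rewrite /=.
  apply: wp_le (leqnn _) _ (step (size L - i.+1) _ _ _ _ _) => //.
  + move=> s2 [J2 e3]; apply: wp_block; first by rewrite /= hp hw.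
    have ei : (size L - i.+1).+1 = size L - i by lia.
    have e4 : p0 + (size L - i.+1) + 1 = p0 + (size L - i) by lia.
    rewrite ei in J2; rewrite /= eqnE eqxx e3 e4; split.
    * exact: ltnW.
    * by apply: Jw; apply: Jp.
    * by rewrite /= !eqnE pw eqxx.
    * rewrite [LHS]/= eqnE eqxx; apply: (hL _ _ J2); lia.
  + lia.
  + exact: Jw.
  + by rewrite /= eqnE pw.
  + by rewrite /= eqnE eqxx e2 /cell ifT ?subn1 //; lia.
Qed.

End Wp.

(** * Freeing registers *)
(** With [m d = 1] this multiplies, with [m y = 1] it divides by [m d]; the preamble uses it to
    recover [n] from [64 * n] and to form [n * n]. *)
Lemma ev_add_loop x y c d k m : 0 < m d -> m c = m d * k ->
  uniq [:: x; c; d] -> y != x -> y != c ->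
  exists m', [/\ ev (While c (line [:: IAdd x x y; ISub c c d])) m (k * 4).+1 m',
    m' x = m x + k * m y & forall a, a != x -> a != c -> m' a = m a].
Proof.
rewrite /= !inE negb_or => d0 + /and3P[/andP[/negbTE xc /negbTE xd] /negbTE cd _].
move=> + /negbTE yx /negbTE yc; elim: k m d0 => [|k IH] m d0 mc.
  exists m; split=> //; last by rewrite addn0.
  by apply: ev_whileF; rewrite mc muln0.
have [] := IH (upd (upd m x (m x + m y)) c (m c - m d)).
- by rewrite /upd eq_sym cd eq_sym xd.
- rewrite /upd eqxx [d == c]eq_sym cd [d == x]eq_sym xd mc mulnS; lia.
move=> m' [e1 e2 e3]; exists m'; split.
- have -> : (k.+1 * 4).+1 = (2 + (k * 4).+1).+2 by lia.
  apply: (@ev_whileT _ _ _ (upd (upd m x (m x + m y)) c (m c - m d)) _ 2).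
  - rewrite mc; lia.
  - apply: (@ev_line [:: IAdd x x y; ISub c c d]); rewrite /= /upd.
    by rewrite [c == x]eq_sym xc [d == x]eq_sym xd.
  - by [].
- by rewrite e2 /upd xc yx yc eqxx; lia.
- by move=> a ax ac; rewrite e3 // /upd (negbTE ax) (negbTE ac).
Qed.

Definition saves k := flatten [seq [:: IAdd 0 0 1; IStore 0 i] | i <- iota 2 k].

(* A row-major index that is a multiple of [n] lies in the last column (or
   outside the matrix), so overwriting register [64 n i] loses no information
   about the strict lower triangle, and frees register [i] without a spare
   register for address computations. *)
Definition preamble :=
  Seq (line (nseq 6 (IAdd 0 0 0)))
 (Seq (line [:: IStore 0 1; IConst 1 0; IAdd 1 1 0])
 (Seq (line (saves 41))
 (Seq (line [:: IConst 3 64; IConst 4 1; IConst 2 0; IConst 5 0; IAdd 5 5 1])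
 (Seq (While 5 (line [:: IAdd 2 2 4; ISub 5 5 3]))
 (Seq (line [:: IConst base 43; IAdd base base 0; IAdd base base 2;
                IConst 5 0; IAdd 5 5 2])
      (While 5 (line [:: IAdd base base 2; ISub 5 5 4]))))))).

Lemma runs_double k m : exists m', [/\ runs (nseq k (IAdd 0 0 0)) m = Some m',
  m' 0 = 2 ^ k * m 0 & forall a, 0 < a -> m' a = m a].
Proof.
elim: k m => [|k IH] m; first by exists m; rewrite mul1n.
have [m' [e1 e2 e3]] := IH (upd m 0 (m 0 + m 0)).
exists m'; split=> //; first by rewrite e2 /upd /= expnS; lia.
by move=> a a0; rewrite e3 // /upd gtn_eqF.
Qed.

(** The stride [64 * n] exceeds 42, so no save hits a low register still to be saved, and 64 is a
    power of two, so the stride arises from [n] by doubling register 0 in place. *)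
Definition saved n enc k (m : memory) :=
  [/\ m 0 = 64 * n * k, m 1 = 64 * n,
      forall i, 0 < i <= k -> m (64 * n * i) = enc i &
      forall a, 1 < a -> (forall i, 0 < i <= k -> a <> 64 * n * i) -> m a = enc a].

Lemma runs_saves n enc k m : 0 < n -> k <= 41 -> saved n enc 1 m ->
  exists2 m', runs (saves k) m = Some m' & saved n enc k.+1 m'.
Proof.
move=> n0 + hm; elim: k => [|k IH] hk; first by exists m.
have [m1 E [h0 h1 hs ho]] := IH (ltnW hk).
exists (upd (upd m1 0 (m1 0 + m1 1)) (64 * n * k.+2) (enc k.+2)).
  rewrite /saves -[k.+1]addn1 iotaD map_cat flatten_cat (runs_cat _ E) /=; congr Some.
  rewrite addn1; congr (upd _ _ _); first by rewrite /upd /= h0 h1 addnC -mulnS.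
  rewrite [LHS]/upd add2n /=; apply: ho => // i hi; nia.
have ne : (64 * n * k.+2 == 0) = false by lia.
have ne1 : (64 * n * k.+2 == 1) = false by nia.
split.
- by rewrite /upd eq_sym ne /= h0 h1 addnC -mulnS.
- by rewrite /upd eq_sym ne1 /= h1.
- move=> i hi; rewrite /upd eqn_pmul2l; last by lia.
  case: eqP => [->//|ik]; rewrite ifF; last by nia.
  apply: hs; lia.
- move=> a a1 ha; rewrite /upd ifF; last by apply/eqP; apply: ha; lia.
  rewrite ifF; last by lia.
  apply: ho => // i hi; apply: ha; lia.
Qed.

(** Beyond the variables and scratch registers, the last save at [64 * n * 42] and the input of
    [n + n * n] cells, so all array cells start out zero. *)
Definition store_base n := 43 + 64 * n * 42 + n + n * n.

Lemma ev_preamble n (enc : memory) : 0 < n -> enc 0 = n ->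
  exists t m', [/\ ev preamble enc t m', t <= 120 + 8 * n,
    [/\ m' 0 = 64 * n * 42, m' 1 = 64 * n, m' 2 = n & m' base = store_base n],
    forall i, 0 < i <= 42 -> m' (64 * n * i) = enc i &
    forall a, tmp2 < a -> (forall i, 0 < i <= 42 -> a <> 64 * n * i) -> m' a = enc a].
Proof.
move=> n0 en.
have [ma [Ea a0 aa]] := runs_double 6 enc.
rewrite en -[2 ^ 6]/64 in a0.
have [mb Eb Sb] : exists2 mb, runs [:: IStore 0 1; IConst 1 0; IAdd 1 1 0] ma = Some mb
    & saved n enc 1 mb.
  eexists; first by [].
  have ne : (64 * n == 0) = false by lia.
  have ne1 : (64 * n == 1) = false by lia.
  rewrite /saved muln1 /upd /= a0 eq_sym ne /=; split=> //.
    move=> i hi; have -> : i = 1 by lia.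
    by rewrite muln1 ne1 eqxx aa.
  move=> a a1 ha; rewrite !ifF; first by rewrite aa //; lia.
  - by apply/eqP; have := ha 1; rewrite muln1; apply.
  - lia.
  - lia.
have [mc Ec [c0 c1 cs co]] := @runs_saves n enc 41 mb n0 (leqnn _) Sb.
(* hiding [saves 41] keeps [lia] from unfolding it *)
have [sv Esv] : {sv | sv = saves 41} by exists (saves 41).
have szv : size sv = 82 by rewrite Esv.
rewrite /preamble -Esv in Ec *; move=> {Esv}.
have [md Ed [d0 d1 [d2 d3 d4 d5] dd]] : exists2 md,
    runs [:: IConst 3 64; IConst 4 1; IConst 2 0; IConst 5 0; IAdd 5 5 1] mc = Some md &
    [/\ md 0 = 64 * n * 42, md 1 = 64 * n, [/\ md 2 = 0, md 3 = 64, md 4 = 1 & md 5 = 64 * n]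
      & forall a, 5 < a -> md a = mc a].
  eexists; first reflexivity.
  rewrite /upd /= c0 c1; move: (64 * n * 42) (64 * n) => x y.
  by split=> // a a5; rewrite !ifF //; lia.
have [me [Ee e2 eo]] := @ev_add_loop 2 4 5 3 n md ltac:(by rewrite d3) ltac:(by rewrite d3 d5)
  isT isT isT.
have [mf Ef [f0 f1 [f2 f4 f5 fb] fo]] : exists2 mf,
    runs [:: IConst base 43; IAdd base base 0; IAdd base base 2; IConst 5 0; IAdd 5 5 2] me = Some mf &
    [/\ mf 0 = 64 * n * 42, mf 1 = 64 * n, [/\ mf 2 = n, mf 4 = 1, mf 5 = n
       & mf base = 43 + 64 * n * 42 + n]
      & forall a, 5 < a -> a <> base -> mf a = mc a].
  eexists; first by [].
  rewrite /upd /= e2 !eo // d0 d1 d2 d4; move: (64 * n * 42) (64 * n) => x y.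
  split=> //; first by split=> //; lia.
  move=> a a5 /eqP/negbTE ab; have a5' : (a == 5) = false by lia.
  by rewrite !ab !a5' eo ?dd //; lia.
have [mg [Eg gb go]] := @ev_add_loop base 2 5 4 n mf ltac:(by rewrite f4) ltac:(by rewrite f4 f5 mul1n)
  isT isT isT.
do 2!eexists; split.
- apply: ev_seq (ev_line Ea) _; apply: ev_seq (ev_line Eb) _.
  apply: ev_seq (ev_line Ec) _; apply: ev_seq (ev_line Ed) _.
  by apply: ev_seq Ee _; apply: ev_seq (ev_line Ef) Eg.
- by rewrite /=; lia.
- rewrite gb !go // f0 f1 f2 fb /store_base; move: (64 * n * 42) (64 * n) => x y.
  by split.
- move=> i hi; have hb : base < 64 * n * i by rewrite /base; nia.
  have h5 : 5 < 64 * n * i by move: hb; rewrite /base; lia.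
  rewrite go ?gtn_eqF // fo //; first exact: cs.
  by move=> E; rewrite E ltnn in hb.
- move=> a ha hna; have hb : base < a by move: ha; rewrite /base /tmp2; lia.
  have h5 : 5 < a by move: hb; rewrite /base; lia.
  rewrite go ?gtn_eqF // fo //; first by apply: co => //; apply: leq_trans h5.
  by move=> E; rewrite E ltnn in hb.
Qed.

(** * The classifier *)
Section Program.
Variables (raw : nat -> nat) (B n : nat) (tg : nat -> nat) (ad : rel nat).
Hypothesis B_gt : tmp2 < B.
Hypothesis n0 : 0 < n.

Local Notation wp := (wp raw B).
Local Notation T := (tsum n tg).
Local Notation W := (width n tg).
Local Notation nbrs := (nbrs n ad).

(* Variables: 2 = n, 3 = tsum, 4 = width, 5 = n * width, 6 = n * (n * width),
   7 = n * n, 8 and 9 = start of the current regions of arrays 6 and 5,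
   10 = remaining rounds, 11 = u, 12 = v, 13 = position in a neighbour list,
   14 = neighbour.
   Arrays: 0 = copy of the input, 1, 2, 3 = multiples of n, width, n * width,
   4 = neighbour lists (entries incremented, zero-terminated),
   5 = width times the class of each node, 6 = capped neighbour counts. *)
Definition copy_input :=
  Seq (block [:: Hconst 10 tmp2])
 (Seq (loop 10 (Seq (Do (ILoad 15 0))
                    (block [:: Haddc 16 10 1; Hput 0 16 15; Hsub 0 0 1])))
 (Seq (block [:: Hconst 7 0; Haddc 10 2 0])
 (Seq (loop 10 (block [:: Hadd 7 7 2]))
 (Seq (block [:: Hadd 10 7 2; Hsubc 10 10 tmp2])
      (loop 10 (Seq (block [:: Haddc 16 10 tmp2.+1])
               (Seq (Do (ILoad 15 16)) (block [:: Hput 0 16 15])))))))).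

Definition blank s := forall k a, 0 < k < 8 -> ar s k a = 0.

(** The first 42 cells come from their saved copies, later ones from their original places, some of
    which hold saves instead of matrix entries. *)
Definition input a :=
  if 0 < a <= 42 then raw (64 * n * a)
  else if (42 < a) && (a <= n * n + n) then raw a else 0.

Lemma wp_copy_input (Q : store -> Prop) s :
  64 * n * 42 < B -> n * n + n < B ->
  va s 0 = 64 * n * 42 -> va s 1 = 64 * n -> va s 2 = n ->
  (forall k a, k < 8 -> ar s k a = 0) ->
  (forall s', va s' 2 = n -> va s' 7 = n * n -> (forall a, ar s' 0 a = input a) ->
     blank s' -> Q s') ->
  wp copy_input (2000 + 70 * (n * n)) Q s.
Proof.
move=> hB1 hB2 e0 e1 e2 zero hQ.
eapply wp_bound; last first.
  apply: wp_seq; apply: (wp_block B_gt) => //; apply: wp_seq.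
  pose I i s := [/\ va s 10 = i, va s 0 = 64 * n * i, va s 1 = 64 * n & va s 2 = n] /\
    [/\ i <= 42, forall a, ar s 0 a = if i < a <= 42 then raw (64 * n * a) else 0 & blank s].
  apply: (wp_loop B_gt (I := I) (N := 42)) => //.
  - rewrite /I /= /upd /=; do !split=> //.
    + by move=> a; rewrite ifF ?zero //; lia.
    + by move=> k a hk; apply: zero; lia.
  - by move=> i s1 [[]].
  - move=> i s1 hi [[a10 a0 a1 a2] [h42 A0 bl]].
    apply: wp_seq; apply: (wp_raw B_gt) => //.
      by rewrite /= /upd /= a0 /tmp2; nia.
    apply: (wp_block B_gt) => //; rewrite /I /= /upd /= a0 a1.
    split; first by split=> //; lia.
    split; [exact: ltnW| |].
    + move=> a; rewrite addn1; case: eqP => [->|ne]; first by rewrite ifT //; lia.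
      by rewrite A0; have -> : (i.+1 < a <= 42) = (i < a <= 42) by lia.
    + by move=> k a hk; rewrite /= eqnE gtn_eqF; [apply: bl | lia].
  move=> s1 [[_ _ _ a2] [_ A0 bl]].
  apply: wp_seq; apply: (wp_block B_gt) => //; apply: wp_seq.
  pose I2 i s := [/\ va s 10 = i, i <= n, va s 7 = n * (n - i) & va s 2 = n] /\
      (ar s 0 = ar s1 0 /\ blank s).
  apply: (wp_loop B_gt (I := I2) (N := n)) => //.
  - by rewrite /I2 /= /upd /= a2 subnn; split=> //; split=> //; lia.
  - by move=> i s2 [[]].
  - move=> i s2 hi [[b10 b1 b7 b2] [B0 bl2]].
    apply: (wp_block B_gt) => //; rewrite /I2 /= /upd /=; split=> //; split=> //; first lia.
    rewrite b7 b2; nia.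
  move=> s2 [[b10 _ b7 b2] [B0 bl2]].
  apply: wp_seq; apply: (wp_block B_gt) => //.
  rewrite subn0 in b7.
  (* The maximum covers small [n], where the truncated loop count is 0. *)
  pose I3 i s := [/\ va s 10 = i, i + 42 <= maxn 42 (n * n + n), va s 7 = n * n & va s 2 = n] /\
    ((forall a, ar s 0 a = if 0 < a <= 42 then raw (64 * n * a)
      else if (42 + i < a) && (a <= n * n + n) then raw a else 0) /\ blank s).
  apply: (wp_loop B_gt (I := I3) (N := n * n + n - 42)) => //.
  - rewrite /I3 /= /upd /= b7 b2; split; first by split=> //; lia.
    split=> // a; rewrite B0 A0; case: ifP => // _.
    by rewrite ifF //; lia.
  - by move=> i s3 [[]].
  - move=> i s3 hi [[c10 c1 c7 c2] [C0 bl3]].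
    apply: wp_seq; apply: (wp_block B_gt) => //.
    apply: wp_seq; apply: (wp_raw B_gt) => //.
      by rewrite /= /upd /= /tmp2; lia.
    apply: (wp_block B_gt) => //; rewrite /I3 /= /upd /= c7 c2.
    split; first by split=> //; lia.
    split=> [a|k a hk]; last by rewrite /= eqnE gtn_eqF; [apply: bl3 | lia].
    rewrite /tmp2; case: eqP => [->|ne]; first by rewrite ifF ?ifT //; lia.
    rewrite C0; case: ifP => // h.
    by have -> : (42 + i.+1 < a) = (42 + i < a) by lia.
  move=> s3 [[_ _ c7 c2] [C0 bl3]]; exact: hQ.
have : n <= n * n by rewrite leq_pmull.
by rewrite /=; lia.
Qed.

Definition make_tables :=
  Seq (block [:: Hconst 3 0; Haddc 10 2 0])
 (Seq (loop 10 (block [:: Haddc 15 10 1; Hget 15 0 15; Hadd 3 3 15]))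
 (Seq (block [:: Hadd 4 3 3; Haddc 4 4 1; Hconst 5 0; Haddc 10 2 0])
 (Seq (loop 10 (block [:: Hadd 5 5 4]))
 (Seq (block [:: Hconst 6 0; Haddc 10 2 0])
 (Seq (loop 10 (block [:: Hadd 6 6 5]))
 (Seq (block [:: Haddc 15 7 0; Haddc 16 5 0; Haddc 17 6 0; Haddc 10 2 0])
      (loop 10 (block [:: Hsub 15 15 2; Hsub 16 16 4; Hsub 17 17 5;
                          Hput 1 10 15; Hput 2 10 16; Hput 3 10 17])))))))).

Definition tables s :=
  [/\ va s 2 = n, va s 3 = T, va s 4 = W, va s 5 = n * W & va s 6 = n * (n * W)] /\
  [/\ forall i, i < n -> ar s 1 i = n * i, forall i, i < n -> ar s 2 i = W * i
     & forall i, i < n -> ar s 3 i = n * W * i].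

Lemma wp_make_tables (Q : store -> Prop) s :
  va s 2 = n -> va s 7 = n * n -> (forall i, i < n -> ar s 0 i.+1 = tg i) -> blank s ->
  (forall s', tables s' -> ar s' 0 = ar s 0 ->
     (forall k a, 3 < k < 8 -> ar s' k a = 0) -> Q s') ->
  wp make_tables (100 + 150 * n) Q s.
Proof.
move=> e2 e7 eT bl hQ.
eapply wp_bound; last first.
  apply: wp_seq; apply: (wp_block B_gt) => //; apply: wp_seq.
  pose I1 i s' := [/\ va s' 10 = i, i <= n, va s' 2 = n, va s' 7 = n * n
    & va s' 3 = \sum_(i <= j < n) tg j] /\ ar s' = ar s.
  apply: (wp_loop B_gt (I := I1) (N := n)) => //.
  - by rewrite /I1 /= /upd /= e2 e7 big_geq // addn0.
  - by move=> i s1 [[]].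
  - move=> i s1 hi [[_ _ b2 b7 b3] A].
    apply: (wp_block B_gt) => //; rewrite /I1 /= /upd /= b2 b7 b3 A addn1 eT //.
    by split=> //; split=> //; [exact: ltnW | rewrite [RHS]big_ltn // addnC].
  move=> s1 [[_ _ b2 b7 b3] A].
  apply: wp_seq; apply: (wp_block B_gt) => //; apply: wp_seq.
  pose I2 i s' := [/\ va s' 10 = i, i <= n, va s' 2 = n, va s' 7 = n * n
    & va s' 3 = T] /\ [/\ va s' 4 = W, va s' 5 = (n - i) * W & ar s' = ar s].
  apply: (wp_loop B_gt (I := I2) (N := n)) => //.
  - by rewrite /I2 /= /upd /= b2 b7 b3 subnn addn1 addn0.
  - by move=> i s2 [[]].
  - move=> i s2 hi [[_ _ c2 c7 c3] [c4 c5 C]].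
    apply: (wp_block B_gt) => //; rewrite /I2 /= /upd /= c2 c7 c3 c4 c5 C.
    split; first by split=> //; exact: ltnW.
    by split=> //; rewrite -mulSnr -subSn.
  move=> s2 [[_ _ c2 c7 c3] [c4 c5 C]]; rewrite subn0 in c5.
  apply: wp_seq; apply: (wp_block B_gt) => //; apply: wp_seq.
  pose I3 i s' := [/\ va s' 10 = i, i <= n, va s' 2 = n, va s' 7 = n * n
    & va s' 3 = T] /\ [/\ va s' 4 = W, va s' 5 = n * W, va s' 6 = (n - i) * (n * W)
    & ar s' = ar s].
  apply: (wp_loop B_gt (I := I3) (N := n)) => //.
  - by rewrite /I3 /= /upd /= c2 c7 c3 c4 c5 subnn addn0.
  - by move=> i s3 [[]].
  - move=> i s3 hi [[_ _ d2 d7 d3] [d4 d5 d6 D]].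
    apply: (wp_block B_gt) => //; rewrite /I3 /= /upd /= d2 d7 d3 d4 d5 d6 D.
    split; first by split=> //; exact: ltnW.
    by split=> //; rewrite -mulSnr -subSn.
  move=> s3 [[_ _ d2 d7 d3] [d4 d5 d6 D]]; rewrite subn0 in d6.
  apply: wp_seq; apply: (wp_block B_gt) => //.
  pose I4 i s' := [/\ va s' 10 = i, i <= n, va s' 2 = n, va s' 3 = T
      & va s' 4 = W] /\ [/\ va s' 5 = n * W, va s' 6 = n * (n * W), va s' 15 = n * i,
      va s' 16 = W * i & va s' 17 = n * W * i] /\
    [/\ forall j, i <= j < n -> ar s' 1 j = n * j, forall j, i <= j < n -> ar s' 2 j = W * j,
      forall j, i <= j < n -> ar s' 3 j = n * W * j, ar s' 0 = ar s 0
     & forall k a, 3 < k < 8 -> ar s' k a = 0].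
  apply: (wp_loop B_gt (I := I4) (N := n)) => //.
  - rewrite /I4 /= /upd /= d2 d3 d4 d5 d6 d7 !addn0; split=> //; split.
      by split=> //; rewrite [RHS]mulnC.
    split=> // [j|j|j||k a hk]; rewrite ?D //; try lia.
    by apply: bl; lia.
  - by move=> i s4 [[]].
  - move=> i s4 hi [[_ _ f2 f3 f4] [[f5 f6 f15 f16 f17] [F1 F2 F3 F0 F]]].
    apply: (wp_block B_gt) => //; rewrite /I4 /= /upd /= f2 f3 f4 f5 f6 f15 f16 f17.
    rewrite [n * i.+1]mulnS [W * i.+1]mulnS [n * W * i.+1]mulnS !addKn.
    split; first by split=> //; exact: ltnW.
    split=> //; split=> // [j hj|j hj|j hj|k a hk].
    + by case: eqP => [->//|ne]; apply: F1; lia.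
    + by case: eqP => [->//|ne]; apply: F2; lia.
    + by case: eqP => [->//|ne]; apply: F3; lia.
    + by rewrite !eqnE !gtn_eqF; [apply: F | lia..].
  move=> s4 [[_ _ f2 f3 f4] [[f5 f6 f15 f16 f17] [F1 F2 F3 F0 F]]].
  by apply: hQ => //; split=> //; split.
by rewrite /=; lia.
Qed.

End Program.

Lemma rowmajor_eq n u k v l : k < n -> l < n ->
  (n * u + k == n * v + l) = (u == v) && (k == l).
Proof.
move=> hk hl; apply/eqP/andP => [E|[/eqP -> /eqP -> //]].
have n0 : 0 < n by lia.
have := congr1 (divn^~ n) E; rewrite ![n * _]mulnC !divnMDl // !divn_small // !addn0 => ->.
by have := congr1 (modn^~ n) E; rewrite ![n * _]mulnC !modnMDl !modn_small // => ->.
Qed.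

Section Lists.
Variables (raw : nat -> nat) (B n : nat) (tg : nat -> nat) (ad : rel nat) (inp : nat -> nat).
Hypothesis B_gt : tmp2 < B.
Hypothesis n0 : 0 < n.
Hypothesis ad_sym : forall u v, ad u v = ad v u.
Hypothesis ad_irr : forall u, ad u u = false.
Hypothesis inp0 : inp 0 = 0.
Hypothesis inp_ad : forall i j, j < i < n -> inp (n * i + j + n + 1) = ad i j.

Local Notation wp := (wp raw B).
Local Notation T := (tsum n tg).
Local Notation W := (width n tg).
Local Notation nbrs := (nbrs n ad).

(** Only the strict lower triangle is reliable, so the pair is read in the row of its larger index;
    for equal indices the address stays 0, where the copied input holds 0. *)
Definition list_body :=
  Seq (block [:: Hsub 15 11 12; Hsub 16 12 11; Hconst 17 0])
 (Seq (If 15 (block [:: Hadd 17 18 12; Hadd 17 17 2; Haddc 17 17 1])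
      (If 16 (block [:: Hget 17 1 12; Hadd 17 17 11; Hadd 17 17 2; Haddc 17 17 1]) Skip))
 (Seq (block [:: Hget 17 0 17])
      (If 17 (block [:: Haddc 17 12 1; Hput 4 13 17; Haddc 13 13 1]) Skip))).

Definition build_lists :=
  Seq (block [:: Haddc 11 2 0])
      (loop 11 (Seq (block [:: Hget 18 1 11; Haddc 13 18 0; Haddc 12 2 0])
                    (loop 12 list_body))).

Definition suffix_nbrs v j := rev [seq w <- iota j (n - j) | ad v w].

Lemma suffix_nbrs0 v : suffix_nbrs v 0 = nbrs v.
Proof. by rewrite /suffix_nbrs subn0. Qed.

Lemma suffix_nbrsS v j : j < n -> suffix_nbrs v j =
  if ad v j then rcons (suffix_nbrs v j.+1) j else suffix_nbrs v j.+1.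
Proof.
move=> jn; rewrite /suffix_nbrs; have -> : n - j = (n - j.+1).+1 by lia.
by rewrite /=; case: ifP => // _; rewrite rev_cons.
Qed.

Lemma size_suffix v j : size (suffix_nbrs v j) <= n - j.
Proof. by rewrite size_rev (leq_trans (size_subseq (filter_subseq _ _))) ?size_iota. Qed.

Lemma cell_rcons L x k : cell (rcons L x) k = if k == size L then x.+1 else cell L k.
Proof.
rewrite /cell size_rcons ltnS nth_rcons leq_eqVlt.
by case: eqP => [->|] /=; [rewrite ltnn | case: ltnP].
Qed.

Definition built (L : nat -> seq nat) s :=
  [/\ tables n tg s, ar s 0 = inp, forall k a, 4 < k < 8 -> ar s k a = 0 &
      forall u k, u < n -> k < n -> ar s 4 (n * u + k) = cell (L u) k].

Definition lists_at u j v :=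
  if v == u then suffix_nbrs u j else if u < v then nbrs v else [::].

Definition list_inv u j s :=
  [/\ va s 11 = u, va s 12 = j, va s 18 = n * u, va s 13 = n * u + size (suffix_nbrs u j)
    & built (lists_at u j) s].

Lemma wp_list_body u j s : u < n -> j < n -> list_inv u j.+1 s ->
  wp list_body 110 (list_inv u j) (setv s 12 j).
Proof.
move=> hu hj [e11 e12 e18 e13 [tb A0 zero LL]].
rewrite -[110]/(7 * 3 + (7 * 3 + (7 * 4 + 0).+2).+2 + (7 + (7 * 3 + 0).+2)+6).
apply: wp_bound (leq_addr _ _) _; rewrite -!addnA.
apply: wp_seq; apply: (wp_block B_gt) => //.
set s1 := hruns _ _.
pose R s' := [/\ inp (va s' 17) = ad u j, forall x, x != 17 -> va s' x = va s1 x & ar s' = ar s1].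
apply: (wp_seq_mid (R := R)).
  apply: wp_if => // h15.
    apply: (wp_block B_gt) => //; rewrite /R; split.
    + rewrite /= /upd /= e18; case: tb => -[-> _ _ _ _] _.
      by rewrite inp_ad //; move: h15; rewrite /= /upd /= e11; lia.
    + by move=> x hx; rewrite /= !eqnE !(negbTE hx).
    + by [].
  move: h15; rewrite /= /upd /= e11 => h15.
  apply: wp_if => //; rewrite /= /upd /= e11 => h16.
    apply: (wp_block B_gt) => //; rewrite /R; split.
    + rewrite /= /upd /= e11; case: tb => -[-> _ _ _ _] [-> // _ _].
      by rewrite inp_ad ?[ad j u]ad_sym //; lia.
    + by move=> x hx; rewrite /= !eqnE !(negbTE hx).
    + by [].
  apply: wp_skip; split=> //; rewrite /= /upd /= inp0.
  have -> : u = j by lia.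
  by rewrite ad_irr.
move=> s2 [h17 fr fa].
have [a11 a12 a18 a13] : [/\ va s2 11 = u, va s2 12 = j, va s2 18 = n * u &
   va s2 13 = n * u + size (suffix_nbrs u j.+1)] by rewrite !fr.
have tb2 : tables n tg s2 by rewrite /tables !fr // fa.
have A02 : ar s2 0 = inp by rewrite fa.
have zero2 k a : 4 < k < 8 -> ar s2 k a = 0 by rewrite fa; apply: zero.
have LL2 v k : v < n -> k < n -> ar s2 4 (n * v + k) = cell (lists_at u j.+1 v) k.
  by rewrite fa; apply: LL.
move: {s1 fr fa R} s2 h17 a11 a12 a18 a13 tb2 A02 zero2 LL2 => s2.
move=> h17 a11 a12 a18 a13 tb2 A02 zero2 LL2.
apply: wp_seq; apply: (wp_block B_gt) => //.
have b17 : va (hruns [:: Hget 17 0 17] s2) 17 = ad u j.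
  by rewrite /= /upd /= A02 h17.
have sz : size (suffix_nbrs u j.+1) < n by have := size_suffix u j.+1; lia.
apply: wp_if => //; rewrite b17 => hb.
  have {}hb : ad u j by case: (ad u j) hb.
  apply: (wp_block B_gt) => //; rewrite /list_inv suffix_nbrsS // hb size_rcons.
  rewrite /= /upd /= a11 a12 a18 a13; split=> //; first by rewrite addn1 addnS.
  split=> //=.
  - by move=> k a hk; rewrite /= eqnE gtn_eqF; [apply: zero2 | lia].
  - move=> v k hv hk; rewrite /upd rowmajor_eq // addn1 LL2 // /lists_at.
    case: (v == u) => //=; by rewrite (suffix_nbrsS u hj) hb cell_rcons.
have {}hb : ad u j = false by case: (ad u j) hb.
apply: wp_skip; rewrite /list_inv suffix_nbrsS // hb; split=> //; split=> //.
by move=> v k hv hk; rewrite LL2 // /lists_at (suffix_nbrsS u hj) hb.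
Qed.

Lemma wp_build_lists (Q : store -> Prop) s :
  built (fun=> [::]) s -> (forall s', built nbrs s' -> Q s') ->
  wp build_lists (10 + 160 * (n * n)) Q s.
Proof.
move=> h0 hQ.
eapply wp_bound; last first.
  apply: wp_seq; apply: (wp_block B_gt) => //.
  pose I u s' := va s' 11 = u /\ built (fun v => if u <= v then nbrs v else [::]) s'.
  apply: (wp_loop B_gt (I := I) (N := n)) => //.
  - case: h0 => tb A0 z L; split; first by rewrite /= /upd /= addn0; case: tb => -[].
    split=> // u k hu hk; rewrite leqNgt hu; exact: L.
  - by move=> i s1 [].
  - move=> u s1 hu [e11 [tb A0 z L]].
    have [[e2 _ _ _ _] [ml _ _]] := tb.
    apply: wp_seq; apply: (wp_block B_gt) => //.
    apply: (wp_loop B_gt (I := list_inv u) (N := n)) => //.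
    + rewrite /list_inv /= /upd /= ml // e2 !addn0 /suffix_nbrs subnn addn0.
      split=> //; split=> // v k hv hk; rewrite L // /lists_at /suffix_nbrs subnn.
      by case: ltngtP => // ->.
    + by move=> j s2 [].
    + by move=> j s2 hj; apply: wp_list_body.
    move=> s2 [f11 _ _ _ [tb2 A2 z2 L2]]; split=> //; split=> // v k hv hk.
    rewrite L2 // /lists_at suffix_nbrs0 [u <= v]leq_eqVlt [u == v]eq_sym.
    by case: eqP => [->|].
  by move=> s1 [_ h]; apply: hQ.
have : n <= n * n by rewrite leq_pmull.
rewrite /=; nia.
Qed.

End Lists.

(* Branch-free: [1 - (1 - x)] is [x != 0] and [2 - (2 - x)] is [minn 2 x]. *)
Definition count_body :=
  [:: Hadd 18 9 14; Hget 18 5 18; Haddc 19 14 1; Hget 19 0 19;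
      Hsub 20 18 15; Hsub 21 15 18; Hadd 20 20 21; Hsub 21 19 16; Hadd 20 20 21;
      Hsub 21 16 19; Hadd 20 20 21; Hconst 21 1; Hsub 20 21 20; Hsub 20 21 20;
      Hadd 19 19 3; Hsub 19 19 16; Hadd 19 19 18; Hadd 19 19 17; Hget 21 6 19;
      Hadd 21 21 20; Hconst 20 2; Hsub 21 20 21; Hsub 21 20 21; Hput 6 19 21].

Definition count_phase :=
  Seq (block [:: Haddc 11 2 0])
      (loop 11 (Seq (block [:: Hadd 15 9 11; Hget 15 5 15; Haddc 16 11 1; Hget 16 0 16;
                               Hget 17 3 11; Hadd 17 17 8; Hget 13 1 11])
                    (walk 13 14 (block count_body)))).

(** Register [t] holds the tag of the node whose list is walked: 24 for [u], 16 for [v]. Register 26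
    accumulates absolute differences of counts, so it stays 0 exactly while all labels agree. *)
Definition compare_with t :=
  [:: Hadd 27 9 14; Hget 27 5 27; Haddc 28 14 1; Hget 28 0 28; Hadd 28 28 3; Hsub 28 28 t;
      Hadd 27 27 28; Hadd 28 27 25; Hget 28 6 28; Hadd 29 27 17; Hget 29 6 29;
      Hsub 27 28 29; Hadd 26 26 27; Hsub 27 29 28; Hadd 26 26 27].

Definition load_pair :=
  [:: Hadd 23 9 11; Hget 23 5 23; Haddc 24 11 1; Hget 24 0 24; Hget 25 3 11; Hadd 25 25 8;
      Hsub 26 23 15; Hsub 27 15 23; Hadd 26 26 27; Hget 13 1 11].

Definition compare_body :=
  Seq (block load_pair)
 (Seq (walk 13 14 (block (compare_with 24)))
 (Seq (block [:: Hget 13 1 12])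
 (Seq (walk 13 14 (block (compare_with 16)))
      (If 26 Skip (block [:: Hget 22 2 11]))))).

Definition load_node :=
  [:: Hadd 15 9 12; Hget 15 5 15; Haddc 16 12 1; Hget 16 0 16;
      Hget 17 3 12; Hadd 17 17 8; Haddc 22 5 0; Haddc 11 2 0].

Definition compare_phase :=
  Seq (block [:: Haddc 12 2 0])
      (loop 12 (Seq (block load_node)
               (Seq (loop 11 compare_body)
                    (block [:: Hadd 23 9 2; Hadd 23 23 12; Hput 5 23 22])))).

(** The region of a round has [n * (n * W)] cells, a number depending on the tags, so it is never
    scanned; advancing 8 and 9 reaches untouched memory. *)
Definition rounds :=
  Seq (block [:: Hconst 8 0; Hconst 9 0; Haddc 10 2 0])
      (loop 10 (Seq count_phase (Seq compare_phase (block [:: Hadd 9 9 2; Hadd 8 8 6])))).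

Definition tally_body :=
  [:: Hadd 16 9 11; Hget 16 5 16; Hsub 17 15 16; Hsub 18 16 15; Hadd 17 17 18;
      Hconst 18 1; Hsub 17 18 17; Hadd 20 20 17].

(** A class size [x] is positive, so [1 - (x - 1)] is 1 exactly for singletons; the last block turns
    the number of singletons into a bit. *)
Definition verdict :=
  Seq (block [:: Hconst 0 0; Haddc 12 2 0])
 (Seq (loop 12 (Seq (block [:: Hconst 20 0; Hadd 15 9 12; Hget 15 5 15; Haddc 11 2 0])
               (Seq (loop 11 (block tally_body))
                    (block [:: Hconst 18 1; Hsubc 20 20 1; Hsub 20 18 20; Hadd 0 0 20]))))
      (block [:: Hconst 18 1; Hsub 0 18 0; Hsub 0 18 0])).

(** * Correctness and cost of the refinement rounds *)

Section Rounds.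
Variables (raw : nat -> nat) (B n : nat) (tg : nat -> nat) (ad : rel nat) (inp : nat -> nat).
Variable D : nat.
Hypothesis B_gt : tmp2 < B.
Hypothesis n0 : 0 < n.
Hypothesis ad_irr : forall u, ad u u = false.
Hypothesis inp_tg : forall i, i < n -> inp i.+1 = tg i.
Hypothesis degree : forall u, u < n -> size (nbrs n ad u) <= D.

Local Notation wp := (wp raw B).
Local Notation T := (tsum n tg).
Local Notation W := (width n tg).
Local Notation nbrs := (nbrs n ad).
Local Notation key := (key n tg).
Local Notation lab := (lab n tg ad).
Local Notation audible := (audible tg).
Local Notation alike := (alike n tg ad).
Local Notation refine := (refine n tg ad).
Local Notation cls := (cls n tg ad).

Definition static s :=
  [/\ tables n tg s, ar s 0 = inp &
      forall u k, u < n -> k < n -> ar s 4 (n * u + k) = cell (nbrs u) k].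

Definition in_round r p q s := [/\ va s 8 = p, va s 9 = q, va s 10 = r & static s].

Definition classes c q (f : nat -> nat) := forall v, v < n -> f (q + v) = W * c v.

(** The second clause hands a blank region to the next round. *)
Definition counts p F (f : nat -> nat) :=
  (forall u x, u < n -> x < n * W -> f (p + (n * W * u + x)) = F u x) /\
  (forall a, p + n * (n * W) <= a -> f a = 0).

(** A node is not its own neighbour, so a row of [n] cells has room for the list and its terminating
    zero. *)
Lemma size_nbrs_lt u : u < n -> size (nbrs u) < n.
Proof.
move=> hu; rewrite size_rev size_filter -[X in _ < X](size_iota 0 n).
rewrite -[X in _ < X](count_predC (ad u)) -[X in X < _]addn0 ltn_add2l -has_count.
by apply/hasP; exists u; rewrite ?mem_iota //= ad_irr.
Qed.

Lemma static_list s u k : static s -> u < n -> k <= size (nbrs u) ->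
  ar s 4 (n * u + k) = cell (nbrs u) k.
Proof. by move=> [_ _ h] hu hk; apply: h => //; apply: leq_ltn_trans hk (size_nbrs_lt hu). Qed.

Lemma nth_nbrs_lt u i : i < size (nbrs u) -> nth 0 (nbrs u) i < n.
Proof. by move/(mem_nth 0); rewrite mem_nbrs => /andP[]. Qed.

Lemma key_lt c v w : v < n -> w < n -> c w < n -> key c v w < n * W.
Proof.
move=> hv hw hc; have := tg_le tg hv; have := tg_le tg hw => h1 h2.
have : W * (c w).+1 <= W * n by rewrite leq_pmul2l.
by rewrite /key mulnS [n * W]mulnC /width; lia.
Qed.

Lemma indicator (a b x y : nat) :
  1 - (1 - (a - b + (b - a) + (x - y) + (y - x))) = (a != b) || (x != y).
Proof. by case: (eqVneq a b); case: (eqVneq x y) => /=; lia. Qed.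

Section Counting.
Variables (r p q : nat) (c : nat -> nat).
Hypothesis c_lt : forall v, v < n -> c v < n.

Definition partial_lab u i x :=
  minn 2 (count (fun w => audible c u w && (key c u w == x)) (take i (nbrs u))).

Definition count_inv g F u i s :=
  [/\ va s 11 = u, va s 15 = W * c u, va s 16 = tg u & va s 17 = n * W * u + p] /\
  [/\ in_round r p q s, ar s 5 = g &
      counts p (fun v x => if v == u then partial_lab u i x else F v x) (ar s 6)].

Lemma count_body_arr s u w : u < n -> w < n -> static s -> classes c q (ar s 5) ->
  va s 9 = q -> va s 14 = w -> va s 15 = W * c u -> va s 16 = tg u ->
  va s 17 = n * W * u + p ->
  let a := p + (n * W * u + key c u w) in
  ar (hruns count_body s) 6 = upd (ar s 6) a (minn 2 (ar s 6 a + audible c u w)).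
Proof.
case: s => vs f hu hw [[[_ e3 _ _ _] _] i0 _] cl e9 e14 e15 e16 e17 a.
rewrite ![va _ _]/= in e3 e9 e14 e15 e16 e17; rewrite [ar _]/= in i0 cl *.
have et : f 0 (w + 1) = tg w by rewrite i0 addn1 inp_tg.
have ec := cl _ hw.
have ea : tg w + T - tg u + W * c w + (n * W * u + p) = a by rewrite /a /key; lia.
have eb : 1 - (1 - (W * c w - W * c u + (W * c u - W * c w) + (tg w - tg u) + (tg u - tg w)))
   = audible c u w by rewrite indicator eqn_pmul2l.
lazy [count_body hruns hstep setv seta va ar eqn].
rewrite e9 e14 e15 e16 e17 e3 et ec ea eb.
by have -> : minn 2 (f 6 a + audible c u w) = 2 - (2 - (f 6 a + audible c u w)) by lia.
Qed.

Lemma wp_count_body g F u i s : u < n -> i < size (nbrs u) -> classes c q g ->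
  count_inv g F u i s ->
  va s 13 = n * u + i -> va s 14 = nth 0 (nbrs u) i ->
  wp (block count_body) 168 (fun s' => count_inv g F u i.+1 s' /\ va s' 13 = n * u + i) s.
Proof.
move=> hu hi cl [[e11 e15 e16 e17] [[e8 e9 e10 st] eg [cn cz]]] e13 e14.
apply: (wp_block B_gt (hs := count_body)) => //; split; last by [].
have hw := nth_nbrs_lt hi; set w := nth _ _ _ in hw e14.
have hk := key_lt hu hw (c_lt hw).
split; first by split.
split; [by split | by [] |].
rewrite (count_body_arr hu hw) ?eg //; split=> [v x hv hx|a ha]; rewrite /upd.
  rewrite eqn_add2l rowmajor_eq // cn // eqxx cn //.
  case: (eqVneq v u) => //= _.
  rewrite /partial_lab (take_nth 0) // -/w -cats1 count_cat /= addn0.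
  rewrite [x == _]eq_sym; case: eqP => [->|_]; last by rewrite andbF addn0.
  by rewrite andbT; case: audible; rewrite ?addn0; lia.
rewrite ifF; first exact: cz.
have : n * W * u + n * W <= n * (n * W) by rewrite -mulnSr mulnC leq_mul2r hu orbT.
by apply: contraTF; lia.
Qed.

Lemma wp_count_phase (Q : store -> Prop) s :
  in_round r p q s -> classes c q (ar s 5) -> counts p (fun _ _ => 0) (ar s 6) ->
  (forall s', in_round r p q s' -> ar s' 5 = ar s 5 -> counts p (lab c) (ar s' 6) -> Q s') ->
  wp count_phase (8 + n * (191 * D + 66)) Q s.
Proof.
move=> h0 cl cn hQ.
eapply wp_bound; last first.
  apply: wp_seq; apply: (wp_block B_gt) => //.
  pose I i s' := va s' 11 = i /\ [/\ in_round r p q s', ar s' 5 = ar s 5 &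
    counts p (fun u x => if i <= u then lab c u x else 0) (ar s' 6)].
  apply: (wp_loop B_gt (I := I) (N := n) (t := 7 * 7 + (191 * D + 8))) => //.
  - case: (h0) => _ _ _ [[[e2 _ _ _ _] _] _ _].
    split; first by rewrite /= /upd /= e2 addn0.
    split=> //; case: cn => cn cz; split=> // u x hu hx; rewrite leqNgt hu; exact: cn.
  - by move=> i s1 [].
  - move=> u s1 hu [e11 [[e8 e9 e10 st] cl1 [cn1 cz1]]].
    have [[_ [mn mw mk]] i0 _] := st.
    apply: wp_seq; apply: (wp_block B_gt) => //.
    (* Here 168 is 7 times the 24 instructions of [count_body], and 23 is the overhead of a walk
       step. *)
    apply: (wp_bound (t := size (nbrs u) * (168 + 23) + 8)).
      by have := degree hu; nia.
    apply: (@wp_walk raw B B_gt (fun i s' => count_inv (ar s 5)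
      (fun v x => if u < v then lab c v x else 0) u i s') (nbrs u) (n * u)) => //.
    + by move=> i s2 [_ [[_ _ _ st2] _ _]] k hk; apply: static_list.
    + by move=> i s2 hi ci e13 e14; apply: wp_count_body.
    + split.
        by rewrite /= /upd /= e9 e8 mk // cl1 cl // i0 addn1 inp_tg.
      split=> //; split=> // v x hv hx; rewrite /= cn1 // ltn_neqAle eq_sym.
      by rewrite /partial_lab take0 /=; case: (v == u).
    + by rewrite /= /upd /= mn.
    move=> s2 [[f11 _ _ _] [ir A5 [cn2 cz2]]]; split=> //; split=> //; split=> // v x hv hx.
    rewrite cn2 // [u <= v]leq_eqVlt [u == v]eq_sym; case: eqP => [->|//].
    by rewrite /partial_lab take_size.
  by move=> s1 [_ [h1 h2 h3]]; apply: hQ.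
by rewrite /=; lia.
Qed.

Definition agree u v y w := lab c u (key c y w) == lab c v (key c y w).

Definition node_inv g f v s :=
  [/\ va s 12 = v, va s 15 = W * c v, va s 16 = tg v & va s 17 = n * W * v + p] /\
  [/\ in_round r p q s, ar s 5 = g & ar s 6 = f].

Definition pair_inv g f u v x b s :=
  [/\ va s 11 = u, va s 22 = x, va s 24 = tg u, va s 25 = n * W * u + p & (va s 26 == 0) = b] /\
  node_inv g f v s.

Lemma compare_value g f u v x b s t y w : u < n -> v < n -> y < n -> w < n ->
  classes c q g -> counts p (lab c) f -> pair_inv g f u v x b s ->
  t = 24 /\ y = u \/ t = 16 /\ y = v -> va s 14 = w ->
  (va (hruns (compare_with t) s) 26 == 0) = b && agree u v y w.
Proof.
move=> hu hv hy hw cl [cn _] [[_ _ e24 e25 e26] [[_ _ e16 e17] [[e8 e9 e10 st] eg ef]]] ht e14.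
have {st} [[[_ e3 _ _ _] _] i0 _] := st.
have [ht' et] : (t = 24 \/ t = 16) /\ va s t = tg y.
  by case: ht => -[-> ->]; split=> //; [left|right].
case: s e3 e8 e9 e10 e14 e16 e17 e24 e25 e26 eg ef i0 et => vs a.
rewrite ![va _ _]/= ![ar _]/= => e3 e8 e9 e10 e14 e16 e17 e24 e25 e26 eg ef i0 et.
have ew : a 0 (w + 1) = tg w by rewrite i0 addn1 inp_tg.
have ec := cl _ hw.
have hk := key_lt hy hw (c_lt hw).
have ek z : z < n -> f (W * c w + (tg w + T - tg y) + (n * W * z + p)) = lab c z (key c y w).
  by move=> hz; rewrite -(cn _ _ hz hk) /key; congr (f _); lia.
have hd k l m : (k + (l - m) + (m - l) == 0) = (k == 0) && (l == m).
  by case: (eqVneq l m) => [->|]; case: (eqVneq k 0) => [->|] /=; lia.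
case: ht' et => -> et; lazy [compare_with hruns hstep setv seta va ar eqn].
  by rewrite ?et ?e9 ?e14 ?e17 ?e25 ?e3 ?ew ?eg ?ef ?ec ?ek // hd e26.
by rewrite ?et ?e9 ?e14 ?e17 ?e25 ?e3 ?ew ?eg ?ef ?ec ?ek // hd e26.
Qed.

Lemma wp_compare_walk g f u v x b t y (Q : store -> Prop) s : u < n -> v < n ->
  classes c q g -> counts p (lab c) f -> pair_inv g f u v x b s ->
  t = 24 /\ y = u \/ t = 16 /\ y = v -> va s 13 = n * y ->
  (forall s', pair_inv g f u v x (b && all (agree u v y) (nbrs y)) s' -> Q s') ->
  wp (walk 13 14 (block (compare_with t))) (128 * D + 8) Q s.
Proof.
move=> hu hv cl cn hs ht e13 hQ.
have hy : y < n by case: ht => -[_ ->].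
have vt : all hvalid (compare_with t) by case: ht => -[-> _].
apply: (wp_bound (t := size (nbrs y) * (105 + 23) + 8)).
  by have := degree hy; nia.
apply: (@wp_walk raw B B_gt
  (fun i => pair_inv g f u v x (b && all (agree u v y) (take i (nbrs y)))) (nbrs y) (n * y)) => //.
- by move=> i s1 [_ [_ [[_ _ _ st] _ _]]] k hk; apply: static_list.
- move=> i s1 hi h1 f13 f14.
  have hw := nth_nbrs_lt hi.
  apply: (wp_block B_gt (hs := compare_with t)) => //.
  have hv1 := compare_value hu hv hy hw cl cn h1 ht f14.
  have et : t = 24 \/ t = 16 by case: ht => -[->]; [left|right].
  rewrite (take_nth 0) // all_rcons [agree _ _ _ _ && _]andbC andbA.
  case: h1 => -[f11 f22 f24 f25 f26] [[f12 f15 f16 f17] [ir f5 f6]].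
  split; last by case: et => ->.
  split; last by case: et => ->.
  by split; [by case: et => -> ..|].
- by rewrite take0 andbT.
- by rewrite take_size.
Qed.

(** On the empty suffix the value is [W * n], the initial content of register 22; each alike [u] met
    on the way down overwrites it. *)
Definition find_inv g f v u s :=
  [/\ va s 11 = u, u <= n &
     va s 22 = W * (u + find (alike c ^~ v) (iota u (n - u)))] /\ node_inv g f v s.

Lemma wp_compare_body g f v u s : v < n -> u < n ->
  classes c q g -> counts p (lab c) f -> find_inv g f v u.+1 s ->
  wp compare_body (256 * D + 102) (find_inv g f v u) (setv s 11 u).
Proof.
move=> hv hu cl cn [[_ _ e22] [[e12 e15 e16 e17] [[e8 e9 e10 st] eg ef]]].
set x := va s 22 in e22.
have [[[e2 e3 _ _ _] [mn mw mk]] i0 _] := st.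
apply: (wp_bound (t := 7 * 10 + ((128 * D + 8) + (7 * 1 + ((128 * D + 8) + (0 + 7).+2))))).
  by lia.
apply: wp_seq; apply: (wp_block B_gt (hs := load_pair)) => //.
have [h13 h] : va (hruns load_pair (setv s 11 u)) 13 = n * u /\
   pair_inv g f u v x (c u == c v) (hruns load_pair (setv s 11 u)).
  have ec : ar s 5 (q + u) = W * c u by rewrite eg cl.
  have et : ar s 0 (u + 1) = tg u by rewrite i0 addn1 inp_tg.
  have ek : ar s 3 u = n * W * u by rewrite mk.
  have el : ar s 1 u = n * u by rewrite mn.
  have hn : node_inv g f v (hruns load_pair (setv s 11 u)) by [].
  split; last split=> //.
    by clear -el; case: s el => vs a; lazy [load_pair hruns hstep setv seta va ar eqn].
  rewrite /x; clear -e8 e9 e15 ec et ek; case: s e8 e9 e15 ec et ek => vs a.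
  rewrite ![va _ _]/= ![ar _]/= => e8 e9 e15 ec et ek.
  lazy [load_pair hruns hstep setv seta va ar eqn]; rewrite ?e9 ?ec ?et ?ek ?e8 ?e15.
  split=> //; rewrite -[c u == c v](eqn_pmul2l (ltn0Sn (T + T))) -/W; lia.
apply: wp_seq; apply: (wp_compare_walk hu hv cl cn h) h13 _; first by left.
move=> s1 h1; apply: wp_seq; apply: (wp_block B_gt) => //.
apply: wp_seq; apply: (wp_compare_walk (t := 16) (y := v) hu hv cl cn (u := u) (x := x)
   (b := (c u == c v) && all (agree u v u) (nbrs u))).
- by [].
- by right.
- case: h1 => _ [[f12 _ _ _] [[_ _ _ [[_ [mn1 _ _]] _ _]] _ _]].
  by rewrite /= f12 mn1.
move=> s2 h2.
have {}h2 : pair_inv g f u v x (alike c u v) s2 by rewrite /alike andbA.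
case: h2 => -[f11 f22 f24 f25 f26] hn.
have Ei : iota u (n - u) = u :: iota u.+1 (n - u.+1).
  by have -> : n - u = (n - u.+1).+1 by lia.
apply: wp_if => // h26.
  apply: wp_skip; split=> //; rewrite Ei /= -f26 (negbTE h26) f22 e22; split=> //; first exact: ltnW.
  by rewrite addnS.
apply: (wp_block B_gt) => //; split=> //.
have [_ [[_ _ _ [[_ [_ mw2 _]] _ _]] _ _]] := hn.
rewrite Ei /= -f26 h26 eqxx addn0 f11 mw2 //; split=> //; exact: ltnW.
Qed.

Lemma wp_compare_phase (Q : store -> Prop) s :
  in_round r p q s -> classes c q (ar s 5) -> counts p (lab c) (ar s 6) ->
  (forall s', in_round r p q s' -> ar s' 6 = ar s 6 ->
     classes (refine c) (q + n) (ar s' 5) -> Q s') ->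
  wp compare_phase (8 + n * (n * (256 * D + 111) + 87)) Q s.
Proof.
move=> h0 cl cn hQ.
apply: (wp_bound (t := 7 * 1 + (n * ((7 * 8 + ((n * (256 * D + 102 + 9)).+1 + 7 * 3)) + 9)).+1)).
  by lia.
apply: wp_seq; apply: (wp_block B_gt) => //.
pose I v s' := va s' 12 = v /\ [/\ in_round r p q s', ar s' 6 = ar s 6, classes c q (ar s' 5) &
  forall w, v <= w < n -> ar s' 5 (q + n + w) = W * refine c w].
apply: (wp_loop B_gt (I := I) (N := n)) => //.
- have [_ _ _ [[[e2 _ _ _ _] _] _ _]] := h0.
  by split; [rewrite /= e2 addn0 | split=> // w; lia].
- by move=> i s1 [].
- move=> v s1 hv [e12 [[e8 e9 e10 st] e6 cl1 new]].
  have [[[e2 e3 e4 e5 _] [mn mw mk]] i0 _] := st.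
  apply: wp_seq; apply: (wp_block B_gt (hs := load_node)) => //.
  apply: wp_seq; apply: (wp_loop B_gt (I := find_inv (ar s1 5) (ar s 6) v) (N := n)) => //.
  + have ec := cl1 _ hv; have et : ar s1 0 (v + 1) = tg v by rewrite i0 addn1 inp_tg.
    have ek : ar s1 3 v = n * W * v by rewrite mk.
    split; last split.
    * rewrite subnn addn0 [W * n]mulnC.
      clear -e2 e5; case: s1 e2 e5 => vs a.
      rewrite ![va _ _]/= => e2 e5; lazy [load_node hruns hstep setv seta va ar eqn].
      by rewrite e2 e5 !addn0.
    * clear -e8 e9 ec et ek; case: s1 e8 e9 ec et ek => vs a.
      rewrite ![va _ _]/= ![ar _]/= => e8 e9 ec et ek.
      lazy [load_node hruns hstep setv seta va ar eqn].
      by rewrite ?e9 ?ec ?et ?ek ?e8.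
    * by split.
  + by move=> i s2 [[]].
  + move=> u s2 hu h2; apply: wp_compare_body => //; by rewrite e6 in h2 *.
  move=> s2 [[_ _ f22] [[f12 f15 f16 f17] [[f8 f9 f10 st2] f5 f6]]].
  apply: (wp_block B_gt) => //; split; first by [].
  have [[[f2 _ _ _ _] _] _ _] := st2.
  split=> // [w hw|w hw]; rewrite /= f9 f2 f12 f5 /upd.
    by rewrite ifF ?cl1 //; lia.
  rewrite eqn_add2l; case: eqP => [->|ne]; first by rewrite f22 subn0.
  by apply: new; lia.
by move=> s1 [_ [h1 h2 h3 h4]]; apply: hQ.
Qed.

End Counting.

Lemma wp_rounds (Q : store -> Prop) s : static s -> (forall k a, 4 < k < 8 -> ar s k a = 0) ->
  (forall s', static s' -> va s' 9 = n * n -> classes (cls n) (n * n) (ar s' 5) -> Q s') ->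
  wp rounds (22 + n * (30 + n * (n * (256 * D + 111) + 87) + n * (191 * D + 66) + 9)) Q s.
Proof.
move=> st z hQ.
apply: (wp_bound (t := 7 * 3 + (n * (((8 + n * (191 * D + 66)) + ((8 + n * (n * (256 * D + 111) + 87)) + 7 * 2)) + 9)).+1)).
  by lia.
apply: wp_seq; apply: (wp_block B_gt) => //.
pose I i s' := i <= n /\ [/\ in_round i ((n - i) * (n * (n * W))) ((n - i) * n) s',
  classes (cls (n - i)) ((n - i) * n) (ar s' 5) &
  forall a, (n - i) * (n * (n * W)) <= a -> ar s' 6 a = 0].
apply: (wp_loop B_gt (I := I) (N := n)) => //.
- have [[[e2 _ _ _ _] _] _ _] := st.
  split=> //; rewrite subnn; split=> [|v _|a _].
  + by split=> //; rewrite /= e2 addn0.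
  + by rewrite /= z // muln0.
  + by rewrite /= z.
- by move=> i s1 [_ [[]]].
- move=> i s1 hi [_ [[e8 e9 e10 st1] cl cz]].
  set k := n - i.+1 in e8 e9 cl cz.
  have ek : n - i = k.+1 by rewrite /k; lia.
  apply: wp_seq.
  apply: (@wp_count_phase i (k * (n * (n * W))) (k * n) (cls k)) => //.
  + by move=> v hv; apply: cls_lt.
  + split=> [u x _ _|a ha]; apply: cz; first exact: leq_addr.
    by apply: leq_trans ha; apply: leq_addr.
  move=> s2 ir2 e5 cn2; apply: wp_seq.
  apply: (@wp_compare_phase i (k * (n * (n * W))) (k * n) (cls k)) => //.
  + by move=> v hv; apply: cls_lt.
  + by rewrite e5.
  move=> s3 [f8 f9 f10 st3] e6 cl3.
  have [[[f2 _ _ _ f6] _] _ _] := st3.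
  apply: (wp_block B_gt) => //; split; first exact: ltnW.
  rewrite ek !mulSnr; split.
  + by split=> //=; rewrite ?f8 ?f9 ?f2 ?f6.
  + exact: cl3.
  + by move=> a ha; rewrite /= e6; case: cn2 => _; apply.
by move=> s1 [_ [[_ e9 _ st1] cl _]]; rewrite subn0 in e9 cl; apply: hQ.
Qed.

Definition single v := count (fun u => cls n u == cls n v) (iota 0 n) <= 1.

Lemma wp_verdict (Q : store -> Prop) s :
  va s 2 = n -> va s 9 = n * n -> classes (cls n) (n * n) (ar s 5) ->
  (forall s', va s' 0 = has single (iota 0 n) -> Q s') ->
  wp verdict (40 + n * (70 + n * 65)) Q s.
Proof.
move=> e2 e9 cl hQ.
apply: (wp_bound (t := 7 * 2 + ((n * ((7 * 4 + ((n * (7 * 8 + 9)).+1 + 7 * 4)) + 9)).+1 + 7 * 3))).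
  by lia.
apply: wp_seq; apply: (wp_block B_gt) => //; apply: wp_seq.
pose I v s' := [/\ va s' 12 = v, v <= n, va s' 0 = count single (iota v (n - v)) & va s' 2 = n]
  /\ va s' 9 = n * n /\ ar s' 5 = ar s 5.
apply: (wp_loop B_gt (I := I) (N := n)) => //.
- by split=> //; rewrite subnn; split=> //; rewrite /= e2 addn0.
- by move=> i s1 [[]].
- move=> v s1 hv [[_ _ f0 f2] [f9 f5]].
  apply: wp_seq; apply: (wp_block B_gt) => //; apply: wp_seq.
  pose J u s' := [/\ va s' 11 = u, u <= n, va s' 15 = W * cls n v &
     va s' 20 = count (fun w => cls n w == cls n v) (iota u (n - u))] /\
     [/\ va s' 12 = v, va s' 0 = va s1 0, va s' 2 = n, va s' 9 = n * n & ar s' 5 = ar s 5].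
  apply: (wp_loop B_gt (I := J) (N := n)) => //.
  + split=> //; rewrite subnn; split=> //; first by rewrite /= f2 addn0.
    by rewrite /= f9 f5 cl.
  + by move=> i s2 [[]].
  + move=> u s2 hu [[_ _ g15 g20] [g12 g0 g2 g9 g5]].
    apply: (wp_block B_gt (hs := tally_body)) => //.
    split; last by split.
    split; [by []|exact: ltnW|by []|].
    have ec : ar s2 5 (n * n + u) = W * cls n u by rewrite g5 cl.
    have -> : n - u = (n - u.+1).+1 by lia.
    rewrite /= -g20 -[cls n u == cls n v](eqn_pmul2l (ltn0Sn (T + T))) -/W.
    clear -g9 g15 ec; case: s2 g9 g15 ec => vs a.
    rewrite ![va _ _]/= ![ar _]/= => g9 g15 ec.
    lazy [tally_body hruns hstep setv seta va ar eqn]; rewrite g9 g15 ec; lia.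
  move=> s2 [[_ _ _ g20] [g12 g0 g2 g9 g5]].
  apply: (wp_block B_gt) => //; split; last by split.
  split=> //; first exact: ltnW.
  have -> : n - v = (n - v.+1).+1 by lia.
  by rewrite /= g0 f0 g20 subn0 /single addnC; congr addn; case: leqP; lia.
move=> s1 [[_ _ f0 _] _]; apply: (wp_block B_gt) => //; apply: hQ.
by rewrite /= f0 subn0 has_count; case: count => [|k]; lia.
Qed.

End Rounds.

(** * Correctness and running time *)
Definition classifier :=
  Seq preamble (Seq copy_input (Seq make_tables (Seq build_lists (Seq rounds verdict)))).

Lemma singleP n tg ad v : v < n ->
  reflect (forall u, u < n -> cls n tg ad n u = cls n tg ad n v -> u = v) (single n tg ad v).
Proof.
move=> hv; rewrite /single; set P := fun u => _.
have Pv : P v by rewrite /P.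
rewrite -size_filter; have U : uniq [seq u <- iota 0 n | P u] by rewrite filter_uniq ?iota_uniq.
have mP u : (u \in [seq u <- iota 0 n | P u]) = P u && (u < n).
  by rewrite mem_filter mem_iota.
apply: (iffP idP) => [h u hu E|h].
  have := mP u; have := mP v; rewrite Pv hv hu /P E eqxx /=.
  case: [seq _ <- _ | _] h => [|a [|b s]] //= _.
  by rewrite !mem_seq1 => /eqP -> /eqP.
apply: (@uniq_leq_size _ _ [:: v] U) => u.
by rewrite mP mem_seq1 => /andP[/eqP E hu]; rewrite (h u).
Qed.

Lemma adjn_sym n (adj : rel 'I_n) : symmetric adj -> forall u v, adjn adj u v = adjn adj v u.
Proof.
by move=> h u v; rewrite /adjn; case: (ord_opt n u) => [i|]; case: (ord_opt n v) => [j|] //.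
Qed.

Lemma adjn_irr n (adj : rel 'I_n) : irreflexive adj -> forall u, adjn adj u u = false.
Proof. by move=> h u; rewrite /adjn; case: (ord_opt n u). Qed.

Lemma size_nbrs_max n (adj : rel 'I_n) (v : 'I_n) : size (nbrs n (adjn adj) v) <= max_degree adj.
Proof.
apply: leq_trans (leq_bigmax (F := fun v => #|[set u | adj v u]|) v).
rewrite cardE {1}/enum_mem size_filter -enumT /nbrs size_rev size_filter.
rewrite -val_enum_ord count_map; apply/eq_leq/eq_count => w.
by rewrite [RHS]inE /= adjnE.
Qed.

Lemma max_degree_gt0 n (adj : rel 'I_n) :
  (forall u v : 'I_n, connect adj u v) -> 1 < n -> 0 < max_degree adj.
Proof.
move=> conn n1; pose u : 'I_n := Ordinal (ltnW n1); pose v := Ordinal n1.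
apply: leq_trans (leq_bigmax (F := fun v => #|[set u | adj v u]|) u).
case/connectP: (conn u v) => -[|w p] //= /andP[auw _] _.
by apply/card_gt0P; exists w; rewrite inE.
Qed.

Section Encoding.
Variables (n : nat) (adj : rel 'I_n) (tag : 'I_n -> nat).
Hypothesis n0 : 0 < n.
Local Notation enc := (encode adj tag).

Lemma encode_tag i : i < n -> enc i.+1 = tagn tag i.
Proof. by move=> hi; rewrite /encode /= hi. Qed.

Lemma encode_adj i j : j < i < n -> enc (n * i + j + n + 1) = adjn adj i j.
Proof.
move=> /andP[ji hi]; have hj := ltn_trans ji hi.
rewrite /encode addn1 /= ifF; last by lia.
rewrite addnK ifT; last by nia.
rewrite [n * i]mulnC divnMDl // modnMDl divn_small // modn_small // addn0 /adjn.
by case: (ord_opt n i) => [a|] //; case: (ord_opt n j).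
Qed.

Lemma encode_out a : n + n * n < a -> enc a = 0.
Proof. by move=> ha; rewrite /encode !ifF //; lia. Qed.

Lemma input_encode (raw : nat -> nat) a :
  (forall i, 0 < i <= 42 -> raw (64 * n * i) = enc i) ->
  (forall a, tmp2 < a -> (forall i, 0 < i <= 42 -> a <> 64 * n * i) -> raw a = enc a) ->
  0 < a <= n * n + n -> (forall i, a <> 64 * n * i) -> input raw n a = enc a.
Proof.
move=> h1 h2 /andP[a0 an] ha; rewrite /input a0 an andbT /=.
case: leqP => h; first by apply: h1; rewrite a0.
by apply: h2.
Qed.

End Encoding.

(** The factor is [D.+1] because cubic terms without [D] remain. *)
Lemma cost_bound n D : 0 < n ->
  120 + 8 * n + ((2000 + 70 * (n * n)) + ((100 + 150 * n) + ((10 + 160 * (n * n)) +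
   ((22 + n * (30 + n * (n * (256 * D + 111) + 87) + n * (191 * D + 66) + 9)) +
    (40 + n * (70 + n * 65)))))) <= 3200 * (n ^ 3 * D.+1).
Proof.
move=> n0; have E : n ^ 3 = n * n * n by rewrite !expnS expn0 muln1 mulnA.
have h2 : n * n <= n * n * n by rewrite leq_pmulr.
have h1 : n <= n * n by rewrite leq_pmulr.
have h3 : n * n * D <= n * n * n * D by rewrite leq_mul2r h2 orbT.
rewrite E mulnS; lia.
Qed.

Lemma wp_classifier n (adj : rel 'I_n) (tag : 'I_n -> nat) (raw : nat -> nat) s (Q : store -> Prop) :
  0 < n -> symmetric adj -> irreflexive adj ->
  (forall i, 0 < i <= 42 -> raw (64 * n * i) = encode adj tag i) ->
  (forall a, tmp2 < a -> (forall i, 0 < i <= 42 -> a <> 64 * n * i) -> raw a = encode adj tag a) ->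
  va s 0 = 64 * n * 42 -> va s 1 = 64 * n -> va s 2 = n ->
  (forall k a, k < 8 -> ar s k a = 0) ->
  (forall s', va s' 0 = has (single n (tagn tag) (adjn adj)) (iota 0 n) -> Q s') ->
  wp raw (store_base n) (Seq copy_input (Seq make_tables (Seq build_lists (Seq rounds verdict))))
   ((2000 + 70 * (n * n)) + ((100 + 150 * n) + ((10 + 160 * (n * n)) +
   ((22 + n * (30 + n * (n * (256 * max_degree adj + 111) + 87) + n * (191 * max_degree adj + 66) + 9)) +
    (40 + n * (70 + n * 65)))))) Q s.
Proof.
move=> n0 sym irr h1 h2 e0 e1 e2 z hQ.
have B_gt : tmp2 < store_base n by rewrite /store_base /tmp2; lia.
have in0 : input raw n 0 = 0 by [].
have in_tg i : i < n -> input raw n i.+1 = tagn tag i.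
  move=> hi; rewrite (input_encode h1 h2) ?encode_tag //; first by lia.
  by move=> [|k]; nia.
have in_ad i j : j < i < n -> input raw n (n * i + j + n + 1) = adjn adj i j.
  move=> hij; rewrite (input_encode h1 h2) ?encode_adj //; first by nia.
  (* The address is [n * i.+1 + j.+1] with [0 < j.+1 < n], not a multiple of [n], so no save has
     overwritten it. *)
  move=> k E; have := @rowmajor_eq n i.+1 j.+1 (64 * k) 0.
  have -> : n * i.+1 + j.+1 == n * (64 * k) + 0 by apply/eqP; lia.
  by rewrite andbF => /(_ _ n0) h; have : true = false by apply: h; lia.
apply: wp_seq; apply: (wp_copy_input B_gt n0) => //.
- by rewrite /store_base; lia.
- by rewrite /store_base; lia.
move=> s1 f2 f7 f0 bl; apply: wp_seq.
apply: (@wp_make_tables _ _ _ (tagn tag) B_gt n0) => //.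
  by move=> i hi; rewrite f0 in_tg.
move=> s2 tb g0 z2; apply: wp_seq.
apply: (@wp_build_lists raw _ n (tagn tag) (adjn adj) (ar s2 0) B_gt n0 (adjn_sym sym) (adjn_irr irr)).
- by rewrite g0 f0.
- by move=> i j hij; rewrite g0 f0 in_ad.
- by split=> // [k a hk|u k _ _]; rewrite z2 //; lia.
move=> s3 [tb3 k0 z3 L3]; apply: wp_seq.
have in_tg3 i : i < n -> ar s2 0 i.+1 = tagn tag i by move=> hi; rewrite g0 f0 in_tg.
apply: (@wp_rounds raw _ n (tagn tag) (adjn adj) (ar s2 0) (max_degree adj) B_gt n0 (adjn_irr irr) in_tg3) => //.
  by move=> u hu; apply: (size_nbrs_max adj (Ordinal hu)).
move=> s4 [[[l2 _ _ _ _] _] _ _] l9 cl.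
exact: (@wp_verdict raw _ n (tagn tag) (adjn adj) B_gt n0).
Qed.

Theorem theorem2 :
  exists (P : program) (c : nat),
    forall (n : nat) (adj : rel 'I_n) (tag : 'I_n -> nat),
      is_configuration adj tag ->
      exists m : memory,
        exec P (c * (n ^ 3 * max_degree adj) + c) (0, encode adj tag) = Some m /\
        (m 0 = 0 \/ m 0 = 1) /\
        (m 0 = 1 <-> feasible adj tag).
Proof.
exists (compile 0 classifier), (2 * 3200) => n adj tag [irr sym conn [v0 _]].
have n0 : 0 < n by apply: leq_ltn_trans (ltn_ord v0).
have [t [m [Em tm [m0 m1 m2 mb] ms mo]]] := @ev_preamble n (encode adj tag) n0 erefl.
(* The memory left by the preamble serves as [raw]; from [store_base n] on it is still zero. *)
have hr : rep m (store_base n) (Store m (fun _ _ => 0)) m.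
  split=> // a i ha; rewrite mo ?encode_out //; rewrite /store_base /tmp2; try by lia.
  by move=> k hk; nia.
have [t' [m' [s' [Em' tm' hr' res]]]] := @wp_classifier n adj tag m (Store m (fun _ _ => 0))
  (fun s' => va s' 0 = has (single n (tagn tag) (adjn adj)) (iota 0 n))
  n0 sym irr ms mo m0 m1 m2 (fun _ _ _ => erefl) (fun _ => id) m hr.
exists m'; split.
  apply: exec_compile (ev_seq Em Em') _.
  have := leq_trans (leq_add tm tm') (cost_bound (max_degree adj) n0).
  move=> /leq_trans; apply.
  (* For [n = 1] the additive constant pays; otherwise the degree [d] is positive and
     [d.+1 <= 2 * d], whence the factor 2 in the constant. *)
  have [n1|n1] := leqP n 1.
    have -> : n ^ 3 = 1 by have -> : n = 1 by lia.
    by rewrite !mul1n; lia.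
  have := max_degree_gt0 conn n1; move: (max_degree adj) (n ^ 3) => d x d0.
  by rewrite mulnS; have : x <= x * d; [rewrite leq_pmulr | lia].
have -> : m' 0 = has (single n (tagn tag) (adjn adj)) (iota 0 n) by rewrite -res (rep_var hr').
split; first by case: has; [right|left].
rewrite feasibleP; split=> [|[v hv h]].
  case: hasP => // -[v]; rewrite mem_iota => /andP[_ hv] /(singleP _ _ hv) h _.
  by exists v.
by rewrite (introT hasP) //; exists v; [rewrite mem_iota | apply/singleP].
Qed.
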